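(* In the New Keynesian model with fairness described in the context (with fairness function allowing a degree of acclimation $\chi\in[0,1]$), over the steady-state inflation rates $\overline{\pi}$ for which the steady-state fairness factor $\overline{F}(\overline{\pi})$ is positive, the steady-state price markup is a strictly decreasing function of steady-state inflation: $$\overline{M}(\overline{\pi})=1+\frac{1}{\varepsilon-1}\cdot\frac{1}{1+\frac{(1-\delta)\gamma}{1-\delta\gamma}\,\overline{\phi}(\overline{\pi})},$$ where $$\overline{\phi}(\overline{\pi})=\frac{\theta\,\overline{M^p}(\overline{\pi})}{\overline{F}(\overline{\pi})},\qquad \overline{M^p}(\overline{\pi})=\frac{\varepsilon}{\varepsilon-1}\exp\!\left(\frac{\gamma}{1-\gamma}\overline{\pi}\right),\qquad \overline{F}(\overline{\pi})=1-\theta(1-\chi)\left[\overline{M^p}(\overline{\pi})-\frac{\varepsilon}{\varepsilon-1}\right].$$ Hence steady-state employment is a strictly increasing function of steady-state inflation: $$\overline{N}=\left[\frac{(\nu-1)\alpha}{\nu}\cdot\frac{1}{\overline{M}(\overline{\pi})}\right]^{1/(1+\eta)}.$$ Thus the long-run Phillips curve (the steady-state relation between $\overline{N}$ and $\overline{\pi}$) is not vertical (fixed $\overline{N}$) but upward sloping.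
   Context: Model. Firms $j\in[0,1]$, households $k\in[0,1]$, discrete time $t$, conditional expectation $\mathbb{E}_t$. Parameters: $\varepsilon>1$, $\nu>1$, $\gamma\in(0,1)$, $\delta\in(0,1)$, $\eta>0$, $\alpha\in(0,1]$, $\psi>1$, $\theta>0$, $\chi\in[0,1]$. Perceptions and fairness. Households do not observe marginal costs; the perceived marginal cost of firm $j$ obeys $C^p_j(t)=[C^p_j(t-1)]^{\gamma}\left[\frac{\varepsilon-1}{\varepsilon}P_j(t)\right]^{1-\gamma}$, and the perceived markup is $M^p_j(t)=P_j(t)/C^p_j(t)$. The fairness factor is $F_j(t)=F(M^p_j(t))>0$, where $F(M^p)=1-\theta\,(M^p-M^f)$ and the fair markup $M^f=\chi\,\overline{M^p}+(1-\chi)\frac{\varepsilon}{\varepsilon-1}$ depends on the steady-state perceived markup $\overline{M^p}$ ($M^f$ is a constant that agents take as given). Let $\phi(M^p)=-\frac{d\ln F}{d\ln M^p}$. Households. With $Z_{jk}(t)=F_j(t)Y_{jk}(t)$ and $Z_k(t)=\left[\int_0^1 Z_{jk}(t)^{(\varepsilon-1)/\varepsilon}dj\right]^{\varepsilon/(\varepsilon-1)}$, household $k$ maximizes $\mathbb{E}_0\sum_{t\ge0}\delta^t\left[\ln Z_k(t)-\frac{N_k(t)^{1+\eta}}{1+\eta}\right]$ by choosing purchases $Y_{jk}(t)$, labor $N_k(t)$, wage $W_k(t)$ and bonds $B_k(t)$, subject to $\int_0^1P_j(t)Y_{jk}(t)dj+Q(t)B_k(t)=W_k(t)N_k(t)+B_k(t-1)+V_k(t)$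 (with $V_k$ dividends), a no-Ponzi constraint, and firms' demand for labor service $k$; it takes fairness factors, prices and dividends as given. The price index is $X(t)=\left\{\int_0^1[P_j(t)/F_j(t)]^{1-\varepsilon}dj\right\}^{1/(1-\varepsilon)}$, and the resulting aggregate demand for good $j$ is $Y^d_j(t)=Z(t)\left[\frac{P_j(t)}{X(t)}\right]^{-\varepsilon}F\!\left(\left(\frac{\varepsilon}{\varepsilon-1}\right)^{1-\gamma}\left[\frac{P_j(t)}{C^p_j(t-1)}\right]^{\gamma}\right)^{\varepsilon-1}$ with $Z(t)=\int_0^1 Z_k(t)dk$. Firms. Firm $j$ produces $Y_j(t)=A_j(t)N_j(t)^{\alpha}$ with $N_j(t)=\left[\int_0^1N_{jk}(t)^{(\nu-1)/\nu}dk\right]^{\nu/(\nu-1)}$. It chooses $Y_j(t),P_j(t),N_{jk}(t)$ to maximize $\mathbb{E}_0\sum_{t\ge0}\Gamma(t)\left[P_j(t)Y_j(t)-\int_0^1W_k(t)N_{jk}(t)dk\right]$ subject to the production function, the demand $Y_j^d$ (taking $Z,X$ as given), and the law of motion of $C^p_j$ (which it internalizes); the stochastic discount factor is $\Gamma(t)=\delta^t\frac{X(0)Z(0)}{X(t)Z(t)}$. Its nominal marginal cost is $C_j(t)=W(t)/[\alpha A_j(t)N_j(t)^{\alpha-1}]$, with $W(t)=\left[\int_0^1W_k(t)^{1-\nu}dk\right]^{1/(1-\nu)}$, and its markup is $M_j(t)=P_j(t)/C_j(t)$. Monetary policy. $i(t)=i_0(t)+\psi\,\pi(t)$ with $i(t)=-\ln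 Q(t)$, $\pi(t)=\ln(P(t)/P(t-1))$, $i_0(t)$ exogenous. Equilibrium. The economy is symmetric (same endowments, dividends, technology $A(t)$, fairness function and initial perceived costs), so subscripts are dropped; goods, labor and bond markets clear; agents' choices satisfy the first-order conditions of their (Lagrangian) problems. In a steady state, $A$ and $i_0$ are constant, real variables are constant, and nominal variables grow at the constant inflation rate $\overline{\pi}=\frac{-\ln\delta-\overline{i_0}}{\psi-1}$, which monetary policy controls through $\overline{i_0}$. Overlines denote steady-state values; $\overline{M}$ is the markup, $\overline{M^p}$ the perceived markup, $\overline{N}$ employment, $\overline{F}=F(\overline{M^p})$, $\overline{\phi}=\phi(\overline{M^p})$. *)

(* Defs.v *)
From mathcomp Require Import all_boot all_order all_algebra.
From mathcomp Require Import all_classical all_reals all_analysis.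
Import Order.TTheory GRing.Theory Num.Theory numFieldNormedType.Exports.

Set Implicit Arguments.
Unset Strict Implicit.
Unset Printing Implicit Defensive.

Local Open Scope classical_set_scope.
Local Open Scope ring_scope.

(* New Keynesian model with fairness concerns.

   Firms j and households k are points of [0,1] with Lebesgue measure; an
   indexed variable is a function on R of which only the restriction to [0,1]
   matters.  Dates are natural numbers; a value dated t - 1 is obtained with
   [lag], from an initial value when t = 0.  Uncertainty is a probability space
   (Om, P) with a filtration Ft; one realization of all the variables is a
   [trajectory], and a stochastic economy is a map Om -> trajectory. *)

Record params (R : realType) := Params {
  epsilon : R; nu : R; gamma : R; delta : R; eta : R; alpha : R;
  psi : R; theta : R; chi : R }.

Definition admissible (R : realType) (p : params R) : Prop :=
  [/\ 1 < epsilon p, 1 < nu p, 0 < gamma p < 1 & 0 < delta p < 1] /\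
  [/\ 0 < eta p, 0 < alpha p <= 1, 1 < psi p, 0 < theta p & 0 <= chi p <= 1].

Section Aggregators.
Variable R : realType.
Implicit Types (x : R -> R) (s : R).

Definition unit_itv : set R := `[0, 1].

Definition int01 x : R := \int[lebesgue_measure]_(i in unit_itv) x i.

Definition ces s x : R :=
  (int01 (fun i => x i `^ ((s - 1) / s))) `^ (s / (s - 1)).

Definition ces_price s x : R :=
  (int01 (fun i => x i `^ (1 - s))) `^ (1 / (1 - s)).

Definition lag (x0 : R) (x : nat -> R) (t : nat) : R :=
  if t is t'.+1 then x t' else x0.

Definition perturb (t : nat) (x : nat -> R) (s : R) : nat -> R :=
  fun tau => if tau == t then x tau + s else x tau.

(* Directions in which a continuum of date-t choices is varied. *)
Definition direction (h : R -> R) : Prop :=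
  measurable_fun unit_itv h /\
  exists c : R, forall i, unit_itv i -> `|h i| <= c.

End Aggregators.

Section Fairness.
Variables (R : realType) (p : params R).

Definition fair_ratio : R := epsilon p / (epsilon p - 1).

(* [Mpbar] is the steady-state perceived markup. *)
Definition fair_markup (Mpbar : R) : R :=
  chi p * Mpbar + (1 - chi p) * fair_ratio.

Definition fairness (Mpbar Mp : R) : R :=
  1 - theta p * (Mp - fair_markup Mpbar).

(* - d ln F / d ln M^p, with the fair markup held fixed *)
Definition fairness_elasticity (Mpbar Mp : R) : R :=
  - derive1 (fun m : R => ln (fairness Mpbar (expR m))) (ln Mp).

Definition next_perceived_cost (c P : R) : R :=
  c `^ gamma p * (fair_ratio^-1 * P) `^ (1 - gamma p).

End Fairness.

Record trajectory (R : realType) := Trajectory {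
  technology : R -> nat -> R;            (* A_j(t) *)
  policy_intercept : nat -> R;           (* i_0(t) *)
  bond_price : nat -> R;                 (* Q(t) *)
  price : R -> nat -> R;                 (* P_j(t) *)
  price_init : R -> R;                   (* P_j(-1) *)
  perceived_cost : R -> nat -> R;        (* C^p_j(t) *)
  perceived_cost_init : R -> R;          (* C^p_j(-1) *)
  output : R -> nat -> R;                (* Y_j(t) *)
  labor_input : R -> R -> nat -> R;      (* N_jk(t), firm first *)
  purchases : R -> R -> nat -> R;        (* Y_jk(t), good first *)
  labor : R -> nat -> R;                 (* N_k(t) *)
  wage : R -> nat -> R;                  (* W_k(t) *)
  bonds : R -> nat -> R;                 (* B_k(t) *)
  bonds_init : R -> R;                   (* B_k(-1) *)
  dividends : R -> nat -> R }.           (* V_k(t) *)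

Section Model.
Variables (R : realType) (p : params R) (Mpbar : R).
Implicit Types (x : trajectory R) (j k : R) (t : nat).

Definition perceived_markup x j t : R := price x j t / perceived_cost x j t.

Definition fairness_factor x j t : R :=
  fairness p Mpbar (perceived_markup x j t).

Definition consumption_index x (Yk : R -> nat -> R) t : R :=
  ces (epsilon p) (fun j => fairness_factor x j t * Yk j t).

(* Z(t) *)
Definition aggregate_consumption x t : R :=
  int01 (fun k => consumption_index x (fun j => purchases x j k) t).

(* X(t) *)
Definition price_index x t : R :=
  ces_price (epsilon p) (fun j => price x j t / fairness_factor x j t).

(* W(t) *)
Definition wage_index x t : R := ces_price (nu p) (fun k => wage x k t).

(* N_j(t) *)
Definition firm_employment x j t : R :=
  ces (nu p) (fun k => labor_input x j k t).

Definition employment x t : R := int01 (fun k => labor x k t).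

(* Under symmetry this is the common price P(t), respectively P(t-1). *)
Definition price_level x t : R := int01 (fun j => price x j t).
Definition lag_price_level x t : R :=
  int01 (fun j => lag (price_init x j) (price x j) t).

Definition inflation x t : R := ln (price_level x t / lag_price_level x t).
Definition interest_rate x t : R := - ln (bond_price x t).

Definition discount_factor x t : R :=
  delta p ^+ t * (price_index x 0 * aggregate_consumption x 0)
    / (price_index x t * aggregate_consumption x t).

(* Demand for good j at date t when its price is P and its past perceived cost
   is c. *)
Definition goods_demand x t (P c : R) : R :=
  aggregate_consumption x t * (P / price_index x t) `^ (- epsilon p)
  * fairness p Mpbar (fair_ratio p `^ (1 - gamma p) * (P / c) `^ gamma p)
      `^ (epsilon p - 1).

(* Firms' total demand for labor service k at wage w: the cost-minimizing
   demands (w / W)^(-nu) N_j, summed over firms. *)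
Definition labor_demand x t (w : R) : R :=
  (w / wage_index x t) `^ (- nu p) * int01 (fun j => firm_employment x j t).

Definition marginal_cost x j t : R :=
  wage_index x t
    / (alpha p * technology x j t * firm_employment x j t `^ (alpha p - 1)).

Definition markup x j t : R := price x j t / marginal_cost x j t.

Record household_plan := HouseholdPlan {
  hh_purchases : R -> nat -> R; hh_labor : nat -> R;
  hh_wage : nat -> R; hh_bonds : nat -> R }.

Definition plan_of_household x k : household_plan :=
  HouseholdPlan (fun j => purchases x j k) (labor x k) (wage x k) (bonds x k).

Definition budget_surplus x k (q : household_plan) t : R :=
  hh_wage q t * hh_labor q t + lag (bonds_init x k) (hh_bonds q) t
  + dividends x k t
  - int01 (fun j => price x j t * hh_purchases q j t)
  - bond_price x t * hh_bonds q t.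

(* Date-t term of the Lagrangian of household k, with multipliers a on the
   budget constraint and b on the demand for labor service k. *)
Definition household_lagrangian x k (a b : nat -> R) (q : household_plan) t
    : R :=
  delta p ^+ t *
  (ln (consumption_index x (hh_purchases q) t)
   - hh_labor q t `^ (1 + eta p) / (1 + eta p)
   + a t * budget_surplus x k q t
   + b t * (labor_demand x t (hh_wage q t) - hh_labor q t)).

Record firm_plan := FirmPlan {
  fm_output : nat -> R; fm_price : nat -> R;
  fm_labor_input : R -> nat -> R; fm_perceived_cost : nat -> R }.

Definition plan_of_firm x j : firm_plan :=
  FirmPlan (output x j) (price x j) (labor_input x j) (perceived_cost x j).

Definition firm_demand_gap x j (q : firm_plan) t : R :=
  goods_demand x t (fm_price q t)
    (lag (perceived_cost_init x j) (fm_perceived_cost q) t) - fm_output q t.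

Definition firm_production_gap x j (q : firm_plan) t : R :=
  technology x j t * ces (nu p) (fun k => fm_labor_input q k t) `^ alpha p
  - fm_output q t.

Definition firm_perception_gap x j (q : firm_plan) t : R :=
  next_perceived_cost p
    (lag (perceived_cost_init x j) (fm_perceived_cost q) t) (fm_price q t)
  - fm_perceived_cost q t.

(* Date-t term of the Lagrangian of firm j, with multipliers on the demand
   curve, the production function and the law of motion of perceived costs. *)
Definition firm_lagrangian x j (mu_d mu_y mu_c : nat -> R) (q : firm_plan) t
    : R :=
  discount_factor x t *
  (fm_price q t * fm_output q t
   - int01 (fun k => wage x k t * fm_labor_input q k t)
   + mu_d t * firm_demand_gap x j q t
   + mu_y t * firm_production_gap x j q t
   + mu_c t * firm_perception_gap x j q t).

Definition positive_trajectory x : Prop :=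
  [/\ forall t, 0 < bond_price x t,
      forall j t, unit_itv j ->
        [/\ 0 < technology x j t, 0 < price x j t, 0 < perceived_cost x j t,
            0 < output x j t & 0 < fairness_factor x j t],
      forall j, unit_itv j -> 0 < price_init x j /\ 0 < perceived_cost_init x j,
      forall k t, unit_itv k -> 0 < labor x k t /\ 0 < wage x k t
    & forall j k t, unit_itv j -> unit_itv k ->
        0 < labor_input x j k t /\ 0 < purchases x j k t].

Definition symmetric_trajectory x : Prop :=
  (forall j j', unit_itv j -> unit_itv j' ->
     [/\ technology x j = technology x j', price x j = price x j',
         price_init x j = price_init x j',
         perceived_cost x j = perceived_cost x j' &
         perceived_cost_init x j = perceived_cost_init x j'] /\
     output x j = output x j') /\
  (forall k k', unit_itv k -> unit_itv k' ->
     [/\ labor x k = labor x k', wage x k = wage x k', bonds x k = bonds x k',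
         bonds_init x k = bonds_init x k' & dividends x k = dividends x k']) /\
  (forall j j' k k', unit_itv j -> unit_itv j' -> unit_itv k -> unit_itv k' ->
     labor_input x j k = labor_input x j' k' /\
     purchases x j k = purchases x j' k').

(* Dividends need no separate equation: the budget constraints and market
   clearing make total dividends equal to total profits. *)
Definition markets_clear x : Prop :=
  [/\ forall j t, unit_itv j ->
        output x j t = int01 (fun k => purchases x j k t),
      forall k t, unit_itv k ->
        labor x k t = int01 (fun j => labor_input x j k t),
      forall t, int01 (fun k => bonds x k t) = 0
    & int01 (bonds_init x) = 0].

Definition monetary_policy x : Prop :=
  forall t, interest_rate x t = policy_intercept x t + psi p * inflation x t.

Definition household_constraints x k : Prop :=
  forall t, budget_surplus x k (plan_of_household x k) t = 0 /\
            labor x k t = labor_demand x t (wage x k t).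

Definition firm_constraints x j : Prop :=
  forall t, [/\ firm_demand_gap x j (plan_of_firm x j) t = 0,
                firm_production_gap x j (plan_of_firm x j) t = 0
              & firm_perception_gap x j (plan_of_firm x j) t = 0].

End Model.

Section Equilibrium.
Variables (R : realType) (p : params R) (Mpbar : R).
Variables (d : measure_display) (Om : measurableType d) (P : probability Om R).
Variable Ft : nat -> set (set Om).

Definition filtration : Prop :=
  [/\ forall t, sigma_algebra setT (Ft t),
      forall t, Ft t `<=` measurable
    & forall t, Ft t `<=` Ft t.+1].

Definition measurable_wrt (G : set (set Om)) (X : Om -> R) : Prop :=
  forall B : set R, measurable B -> G (X @^-1` B).

Definition adapted (X : Om -> nat -> R) : Prop :=
  forall t, measurable_wrt (Ft t) (fun om => X om t).

(* Y is a version of the conditional expectation of X given G. *)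
Definition is_condexp (G : set (set Om)) (X Y : Om -> R) : Prop :=
  [/\ P.-integrable setT (EFin \o X), P.-integrable setT (EFin \o Y),
      measurable_wrt G Y
    & forall A, G A ->
        (\int[P]_(om in A) (X om)%:E = \int[P]_(om in A) (Y om)%:E)%E].

(* First-order condition of E_0 \sum_tau L(tau) for a variable chosen at date
   t: [L om tau s] is the term of date tau when the variable is moved by s in
   state om.  A variable chosen at t enters finitely many terms, all dated at
   most t + 1, so that the derivative of the series is that of any partial sum
   that includes them. *)
Definition first_order_condition (t : nat) (L : Om -> nat -> R -> R) : Prop :=
  exists D : Om -> nat -> R,
    (forall om tau, is_derive (0 : R) (1 : R) (L om tau) (D om tau)) /\
    (forall T, (t.+1 < T)%N ->
       is_condexp (Ft t) (fun om => \sum_(tau < T) D om tau) (cst 0)).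

Implicit Type e : Om -> trajectory R.

Definition household_focs e (k : R) (a b : Om -> nat -> R) : Prop :=
  let q om := plan_of_household (e om) k in
  let L om tau q' :=
    household_lagrangian p Mpbar (e om) k (a om) (b om) q' tau in
  forall t,
  [/\ forall h, direction h ->
        first_order_condition t (fun om tau s => L om tau
          (HouseholdPlan
             (fun j => perturb t (hh_purchases (q om) j) (s * h j))
             (hh_labor (q om)) (hh_wage (q om)) (hh_bonds (q om)))),
      first_order_condition t (fun om tau s => L om tau
        (HouseholdPlan (hh_purchases (q om)) (perturb t (hh_labor (q om)) s)
           (hh_wage (q om)) (hh_bonds (q om)))),
      first_order_condition t (fun om tau s => L om tau
        (HouseholdPlan (hh_purchases (q om)) (hh_labor (q om))
           (perturb t (hh_wage (q om)) s) (hh_bonds (q om))))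
    & first_order_condition t (fun om tau s => L om tau
        (HouseholdPlan (hh_purchases (q om)) (hh_labor (q om))
           (hh_wage (q om)) (perturb t (hh_bonds (q om)) s)))].

Definition firm_focs e (j : R) (mu_d mu_y mu_c : Om -> nat -> R) : Prop :=
  let q om := plan_of_firm (e om) j in
  let L om tau q' :=
    firm_lagrangian p Mpbar (e om) j (mu_d om) (mu_y om) (mu_c om) q' tau in
  forall t,
  [/\ first_order_condition t (fun om tau s => L om tau
        (FirmPlan (perturb t (fm_output (q om)) s) (fm_price (q om))
           (fm_labor_input (q om)) (fm_perceived_cost (q om)))),
      first_order_condition t (fun om tau s => L om tau
        (FirmPlan (fm_output (q om)) (perturb t (fm_price (q om)) s)
           (fm_labor_input (q om)) (fm_perceived_cost (q om)))),
      forall h, direction h ->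
        first_order_condition t (fun om tau s => L om tau
          (FirmPlan (fm_output (q om)) (fm_price (q om))
             (fun k => perturb t (fm_labor_input (q om) k) (s * h k))
             (fm_perceived_cost (q om))))
    & first_order_condition t (fun om tau s => L om tau
        (FirmPlan (fm_output (q om)) (fm_price (q om))
           (fm_labor_input (q om))
           (perturb t (fm_perceived_cost (q om)) s)))].

(* Discounted expected bond holdings must not become negative in the limit;
   the holdings B_k(t) cost Q(t) B_k(t) and are discounted with Gamma(t). *)
Definition no_ponzi e (k : R) : Prop :=
  (0 <= limn_einf (fun t => \int[P]_om
     (discount_factor p Mpbar (e om) t * bond_price (e om) t
        * bonds (e om) k t)%:E))%E.

Definition household_optimum e (k : R) : Prop :=
  [/\ forall om, household_constraints p (e om) k, no_ponzi e k
    & exists a b : Om -> nat -> R,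
        [/\ adapted a, adapted b & household_focs e k a b]].

Definition firm_optimum e (j : R) : Prop :=
  (forall om, firm_constraints p Mpbar (e om) j) /\
  exists mu_d mu_y mu_c : Om -> nat -> R,
    [/\ adapted mu_d, adapted mu_y, adapted mu_c
      & firm_focs e j mu_d mu_y mu_c].

Definition adapted_economy e : Prop :=
  [/\ adapted (fun om => policy_intercept (e om)),
      adapted (fun om => bond_price (e om)),
      forall j, unit_itv j ->
        [/\ adapted (fun om => technology (e om) j),
            adapted (fun om => price (e om) j),
            adapted (fun om => perceived_cost (e om) j),
            adapted (fun om => output (e om) j)
          & measurable_wrt (Ft 0) (fun om => price_init (e om) j) /\
            measurable_wrt (Ft 0) (fun om => perceived_cost_init (e om) j)],
      forall k, unit_itv k ->
        [/\ adapted (fun om => labor (e om) k),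
            adapted (fun om => wage (e om) k),
            adapted (fun om => bonds (e om) k),
            adapted (fun om => dividends (e om) k)
          & measurable_wrt (Ft 0) (fun om => bonds_init (e om) k)]
    & forall j k, unit_itv j -> unit_itv k ->
        adapted (fun om => labor_input (e om) j k) /\
        adapted (fun om => purchases (e om) j k)].

Definition equilibrium e : Prop :=
  [/\ adapted_economy e,
      forall om, [/\ positive_trajectory p Mpbar (e om), symmetric_trajectory (e om),
                     markets_clear (e om) & monetary_policy p (e om)],
      forall k, unit_itv k -> household_optimum e k
    & forall j, unit_itv j -> firm_optimum e j].

(* In a steady state no variable depends on the state of the world. *)
Definition constant_at (c : R) (X : Om -> nat -> R) : Prop :=
  forall om t, X om t = c.

Definition steady (X : Om -> nat -> R) : Prop := exists c, constant_at c X.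

Definition grows_at (pi : R) (X : Om -> nat -> R) : Prop :=
  exists c, forall om t, X om t = c * expR (pi * t%:R).

(* Nominal variables with an initial value grow at rate pi from date -1 on. *)
Definition steady_state (Abar i0bar pi : R) e : Prop :=
  [/\ (forall j, unit_itv j ->
         constant_at Abar (fun om => technology (e om) j)) /\
      constant_at i0bar (fun om => policy_intercept (e om)),
      (forall j, unit_itv j -> steady (fun om => output (e om) j)) /\
      (forall k, unit_itv k -> steady (fun om => labor (e om) k)) /\
      (forall j k, unit_itv j -> unit_itv k ->
         steady (fun om => labor_input (e om) j k) /\
         steady (fun om => purchases (e om) j k)),
      forall j, unit_itv j ->
        grows_at pi (fun om => lag (price_init (e om) j) (price (e om) j)) /\
        grows_at pi (fun om => lag (perceived_cost_init (e om) j)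
                                   (perceived_cost (e om) j)),
      forall k, unit_itv k ->
        [/\ grows_at pi (fun om => wage (e om) k),
            grows_at pi (fun om => lag (bonds_init (e om) k) (bonds (e om) k))
          & grows_at pi (fun om => dividends (e om) k)]
    & forall j, unit_itv j ->
        constant_at Mpbar (fun om => perceived_markup (e om) j)].

End Equilibrium.

(* The parameter Mpbar that enters the fair markup is the perceived markup of
   the steady state itself. *)
Definition steady_state_equilibrium (R : realType) (p : params R)
    (d : measure_display) (Om : measurableType d) (P : probability Om R)
    (Ft : nat -> set (set Om)) (Abar i0bar pi Mpbar : R) (e : Om -> trajectory R)
    : Prop :=
  equilibrium p Mpbar P Ft e /\ steady_state Mpbar Abar i0bar pi e.

(* Pairs (steady-state inflation, steady-state employment), traced out by
   varying the constant policy intercept. *)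
Definition long_run_phillips_curve (R : realType) (p : params R)
    (d : measure_display) (Om : measurableType d) (P : probability Om R)
    (Ft : nat -> set (set Om)) (Abar : R) : set (R * R) :=
  [set c | exists (i0bar Mpbar : R) (e : Om -> trajectory R),
     steady_state_equilibrium p P Ft Abar i0bar c.1 Mpbar e /\
     forall om t, employment (e om) t = c.2].

Section ClosedForms.
Variables (R : realType) (p : params R).

Definition ss_perceived_markup (pi : R) : R :=
  epsilon p / (epsilon p - 1) * expR (gamma p / (1 - gamma p) * pi).

Definition ss_fairness (pi : R) : R :=
  1 - theta p * (1 - chi p)
      * (ss_perceived_markup pi - epsilon p / (epsilon p - 1)).

Definition ss_elasticity (pi : R) : R :=
  theta p * ss_perceived_markup pi / ss_fairness pi.

Definition ss_markup (pi : R) : R :=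
  1 + 1 / (epsilon p - 1)
      * (1 / (1 + (1 - delta p) * gamma p / (1 - delta p * gamma p)
                  * ss_elasticity pi)).

Definition ss_employment (pi : R) : R :=
  ((nu p - 1) * alpha p / nu p * (1 / ss_markup pi)) `^ (1 / (1 + eta p)).

End ClosedForms.

(* Main.v *)
(** Along a symmetric path every cross-sectional aggregate is that of a constant
    function, so moving all the goods, or all the kinds of labor, by the same
    amount already gives the relevant first-order conditions.  In a steady state
    these conditions are affine in the multipliers with deterministic
    coefficients; integrating over the whole probability space, they determine
    the means of the multipliers, and eliminating these means leaves three scalar
    equations: the wage-setting equation, the Euler equation of bonds and a
    price-setting equation.  At constant inflation the price-setting equation is
    [D (epsilon + (epsilon - 1) kappa) = 1], where [D = 1 - 1/M] and [kappa] is
    the elasticity of fairness times [(1 - delta) gamma / (1 - delta gamma)].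
    The elasticity increases with inflation, through the perceived markup, so
    the markup decreases and employment increases.  Conversely, the same
    multipliers, taken deterministic, support a constant-growth path as an
    equilibrium for every inflation rate at which fairness is positive; there the
    first-order conditions must be checked in all directions, which requires
    differentiating the CES aggregator under the integral sign. *)

Require Import Defs.
From mathcomp Require Import all_boot all_order all_algebra.
From mathcomp Require Import all_classical all_reals all_analysis.
From mathcomp Require Import measurable_realfun ring lra.
Import Order.TTheory GRing.Theory Num.Theory numFieldNormedType.Exports.

Set Implicit Arguments.
Unset Strict Implicit.
Unset Printing Implicit Defensive.

Local Open Scope classical_set_scope.
Local Open Scope ring_scope.

(** * Derivatives and aggregators *)

Section PointwiseDerivatives.
Context {R : realType}.
Implicit Types (f g : R -> R) (x df dg c a : R).

(** The differentiation rules are restated for functions written as pointwise lambda terms, so that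
    unification with a Lagrangian term selects the rule and builds the derivative. *)
Lemma is_derive_fcst c x : is_derive x (1 : R) (fun=> c) 0.
Proof. exact: is_derive_cst. Qed.

Lemma is_derive_fid x : is_derive x (1 : R) (fun y => y) 1.
Proof. exact: is_derive_id. Qed.

Lemma is_derive_fD f g x df dg : is_derive x (1 : R) f df ->
  is_derive x (1 : R) g dg -> is_derive x (1 : R) (fun y => f y + g y) (df + dg).
Proof. by move=> ? ?; exact: is_deriveD. Qed.

Lemma is_derive_fN f x df : is_derive x (1 : R) f df ->
  is_derive x (1 : R) (fun y => - f y) (- df).
Proof. by move=> ?; exact: is_deriveN. Qed.

Lemma is_derive_fM f g x df dg : is_derive x (1 : R) f df ->
  is_derive x (1 : R) g dg ->
  is_derive x (1 : R) (fun y => f y * g y) (f x * dg + g x * df).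
Proof. by move=> ? ?; exact: is_deriveM. Qed.

Lemma is_derive_fpowR f x df a : 0 < f x -> is_derive x (1 : R) f df ->
  is_derive x (1 : R) (fun y => f y `^ a) (a * f x `^ (a - 1) * df).
Proof.
move=> f0 ?; apply: (@is_derive1_comp _ (@powR R ^~ a)).
exact: is_derive1_powR.
Qed.

Lemma is_derive_fln f x df : 0 < f x -> is_derive x (1 : R) f df ->
  is_derive x (1 : R) (fun y => ln (f y)) ((f x)^-1 * df).
Proof. by move=> f0 ?; apply: is_derive1_comp; exact: is_derive1_ln. Qed.

Lemma is_derive_fexpR f x df : is_derive x (1 : R) f df ->
  is_derive x (1 : R) (fun y => expR (f y)) (expR (f x) * df).
Proof. by move=> ?; apply: is_derive1_comp. Qed.

Lemma is_derive_fV f x df : f x != 0 -> is_derive x (1 : R) f df ->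
  is_derive x (1 : R) (fun y => (f y)^-1) (- (f x) ^- 2 * df).
Proof.
by move=> f0 [? <-]; apply: DeriveDef; [exact: derivableV|exact: deriveV].
Qed.

End PointwiseDerivatives.

(** Meant to run under [is_derive_eq], where the derivative is still an existential variable.
    Hypotheses are tried before the compound rules, so a derivative already established for a
    subterm is taken as it is; side conditions on powers, logarithms and inverses are left to the
    caller. *)
Ltac derive_step := first
  [ eapply is_derive_fcst | eapply is_derive_fid | eassumption
  | eapply is_derive_fD | eapply is_derive_fN | eapply is_derive_fM
  | eapply is_derive_fpowR | eapply is_derive_fln | eapply is_derive_fexpR
  | eapply is_derive_fV].

(** * Integrals and CES aggregators over the unit interval *)

Section Aggregation.
Context {R : realType}.
Implicit Types (x y h : R -> R) (s c a : R).

Local Notation I01 := (@unit_itv R).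
Local Notation mu := (@lebesgue_measure R).

Lemma measurable_unit_itv : measurable I01.
Proof. exact: measurable_itv. Qed.
#[local] Hint Resolve measurable_unit_itv : core.

Lemma unit_itv0 : I01 0.
Proof. by rewrite /unit_itv /= in_itv /= lexx ler01. Qed.

Lemma lebesgue_measure_unit_itv : mu I01 = 1%E.
Proof. by rewrite lebesgue_measure_itv /= lte01 oppr0 adde0. Qed.

Lemma eq_int01 x y : (forall i, unit_itv i -> x i = y i) -> int01 x = int01 y.
Proof. by move=> xy; apply: eq_Rintegral => i /set_mem; exact: xy. Qed.

Lemma int01_cst x c : (forall i, unit_itv i -> x i = c) -> int01 x = c.
Proof.
move=> /eq_int01 ->; rewrite /int01 Rintegral_cst//.
by rewrite (_ : fine _ = 1) ?mulr1//; exact: (congr1 fine lebesgue_measure_unit_itv).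
Qed.

Lemma ces_cst s x c : 1 < s -> 0 <= c -> (forall i, unit_itv i -> x i = c) ->
  ces s x = c.
Proof.
move=> s1 c0 xc; rewrite /ces (@int01_cst _ (c `^ ((s - 1) / s))).
  rewrite -powRrM (_ : _ * _ = 1) ?powRr1//; field.
  by rewrite subr_eq0 !gt_eqF// (lt_trans ltr01).
by move=> i /xc ->.
Qed.

Lemma eq_ces s x y : (forall i, unit_itv i -> x i = y i) -> ces s x = ces s y.
Proof.
move=> xy; rewrite /ces (@eq_int01 _ (fun i => y i `^ ((s - 1) / s)))//.
by move=> i /xy ->.
Qed.

Lemma ces_price_cst s x c : 1 < s -> 0 <= c ->
  (forall i, unit_itv i -> x i = c) -> ces_price s x = c.
Proof.
move=> s1 c0 xc; rewrite /ces_price (@int01_cst _ (c `^ (1 - s))).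
  rewrite -powRrM (_ : _ * _ = 1) ?powRr1//; field.
  by rewrite subr_eq0 lt_eqF.
by move=> i /xc ->.
Qed.

Lemma bounded_int01_integrable x c : measurable_fun I01 x ->
  (forall i, unit_itv i -> `|x i| <= c) -> mu.-integrable I01 (EFin \o x).
Proof.
move=> mx xc; apply: measurable_bounded_integrable => //.
  by rewrite (_ : _ I01 = 1%E) ?ltry//; exact: lebesgue_measure_unit_itv.
exists c; split; [exact: num_real|move=> M cM i Ii].
by apply: le_trans (xc _ Ii) _; exact: ltW.
Qed.

Lemma direction_integrable h : direction h ->
  mu.-integrable I01 (EFin \o h).
Proof. by move=> [mh [c hc]]; exact: bounded_int01_integrable hc. Qed.

Lemma direction_cst c : direction (fun=> c : R).
Proof. by split; [exact: measurable_cst|exists `|c|]. Qed.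

Lemma directionZ c h : direction h -> direction (fun i => c * h i).
Proof.
move=> [mh [k hk]]; split; first exact: measurable_funM.
by exists (`|c| * k) => i ii; rewrite normrM ler_wpM2l// hk.
Qed.

Lemma int01Z c h : direction h -> int01 (fun i => c * h i) = c * int01 h.
Proof. by move=> /direction_integrable hi; exact: RintegralZl. Qed.

Lemma int01_affine c s h : direction h ->
  int01 (fun i => c + s * h i) = c + s * int01 h.
Proof.
move=> dh; rewrite /int01 RintegralD//.
- by rewrite -!/(int01 _) int01Z// (@int01_cst _ c).
- exact/direction_integrable/direction_cst.
- exact/direction_integrable/directionZ.
Qed.

(** Differentiation under the integral sign. Since [h] is bounded, for small [s] the base
    [c + s * h i] stays away from 0 uniformly in [i], and the integrand then has a derivative
    bounded by a constant, which is integrable on a set of measure 1. *)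
Lemma is_derive_int01_powR a c h : 0 <= a <= 1 -> 0 < c -> direction h ->
  is_derive (0 : R) (1 : R) (fun s => int01 (fun i => (c + s * h i) `^ a))
    (a * c `^ (a - 1) * int01 h).
Proof.
move=> /andP[a0 a1] c0 dh; have [mh [K0 hK0]] := dh.
(* The bound of a direction may be zero or even negative when stated for an arbitrary constant; this
   one is positive and can be divided by. *)
pose K := `|K0| + 1; have K_gt0 : 0 < K by rewrite /K ltr_wpDl.
have hK i : unit_itv i -> `|h i| <= K.
  by move=> /hK0 /le_trans; apply; rewrite (le_trans (ler_norm _))// lerDl.
(* The radius is chosen so that [s * h i] has absolute value at most [c / 2]. *)
pose u := c / 2 / K; have u0 : 0 < u by rewrite !divr_gt0.
have near_c s i : s \in `](- u), u[ -> unit_itv i ->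
    c / 2 <= c + s * h i <= 2 * c.
  rewrite in_itv /= => su ii.
  have : `|s * h i| <= c / 2.
    rewrite normrM (_ : c / 2 = u * K) ?ler_pM ?hK//; last first.
      by rewrite /u divfK// gt_eqF.
    by rewrite ler_norml; case/andP: su => /ltW-> /ltW->.
  by rewrite ler_norml => /andP[]; lra.
pose f (s i : R) := (c + s * h i) `^ a.
(* The exponent [a - 1] is nonpositive, so the power in the derivative is largest at the lower bound
   [c / 2] of the base. *)
pose G := a * K / (c / 2) `^ (1 - a).
have df s i : s \in `](- u), u[ -> unit_itv i ->
    is_derive s (1 : R) (f ^~ i) (a * (c + s * h i) `^ (a - 1) * h i).
  move=> su ii; apply: is_derive_eq.
    eapply is_derive_fpowR; last by do ! derive_step.
    by case/andP: (near_c _ _ su ii) => + _; apply: lt_le_trans; rewrite divr_gt0.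
  by rewrite mulr0 mulr1 add0r add0r.
have d1E s i : s \in `](- u), u[ -> unit_itv i ->
    partial1of2 f s i = a * (c + s * h i) `^ (a - 1) * h i.
  by move=> su ii; rewrite partial1of2E; apply: derive_val; exact: df.
have mf s : measurable_fun I01 (f s).
  apply: (measurableT_comp (measurable_powR _)) => //.
  by apply: measurable_funD => //; exact: measurable_funM.
have u00 : (0 : R) \in `](- u), u[ by rewrite in_itv /= u0 oppr_lt0 u0.
have intf s : s \in `](- u), u[ -> mu.-integrable I01 (EFin \o f s).
  move=> su; apply: (@bounded_int01_integrable _ ((2 * c) `^ a)) => //.
  move=> i ii; rewrite ger0_norm ?powR_ge0//.
  case/andP: (near_c _ _ su ii) => cl cu.
  by apply: ge0_ler_powR; rewrite ?nnegrE//; lra.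
have G0 : 0 <= G by rewrite /G divr_ge0 ?mulr_ge0 ?powR_ge0// ltW.
have intG : mu.-integrable I01 (EFin \o (fun=> G)).
  exact/direction_integrable/direction_cst.
have Gub s i : s \in `](- u), u[ -> unit_itv i -> `|partial1of2 f s i| <= G.
  move=> su ii; rewrite d1E// !normrM (ger0_norm a0) /G.
  rewrite -mulrA (mulrC `|_ `^ _|) mulrA ler_pM ?mulr_ge0//.
    by rewrite ler_wpM2l// hK.
  rewrite -(opprB 1 a) powRN normfV ger0_norm ?powR_ge0//.
  case/andP: (near_c _ _ su ii) => cl cu.
  have c20 : 0 < c / 2 by rewrite divr_gt0.
  rewrite lef_pV2 ?posrE ?powR_gt0// ?(lt_le_trans c20)//.
  by apply: ge0_ler_powR; rewrite ?nnegrE ?subr_ge0//; lra.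
have der s i : s \in `](- u), u[ -> unit_itv i -> derivable (f ^~ i) s 1.
  by move=> su ii; apply: ex_derive; exact: df.
have D := @derivable_under_integral R _ _ mu f I01 measurable_unit_itv
  0 (- u) u u00 intf der _ (fun=> G0) intG Gub.
have E := @differentiation_under_integral R _ _ mu f I01 measurable_unit_itv
  0 (- u) u u00 intf der _ (fun=> G0) intG Gub.
apply: DeriveDef; first exact: D.
rewrite -derive1E E -int01Z//; apply: eq_int01 => i ii.
by rewrite d1E// mul0r addr0.
Qed.

(** At a constant profile all weights are equal and the aggregator has degree one, so its derivative
    is the mean of the direction: the inner and outer exponents are inverse to each other and the
    powers of [c] cancel. *)
Lemma is_derive_ces s c h : 1 < s -> 0 < c -> direction h ->
  is_derive (0 : R) (1 : R) (fun r => ces s (fun i => c + r * h i)) (int01 h).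
Proof.
move=> s1 c0 dh; have s0 : 0 < s := lt_trans ltr01 s1.
have s10 : 0 < s - 1 by rewrite subr_gt0.
set a := (s - 1) / s; have a0 : 0 < a by rewrite divr_gt0.
have a1 : a <= 1 by rewrite /a ler_pdivrMr// mul1r lerBlDr lerDl.
have at0 : int01 (fun i => (c + 0 * h i) `^ a) = c `^ a.
  by apply: int01_cst => i _; rewrite mul0r addr0.
apply: is_derive_eq.
  apply: is_derive_fpowR; last by apply: is_derive_int01_powR => //; rewrite (ltW a0).
  by rewrite at0 powR_gt0.
have sE : s / (s - 1) = a^-1 by rewrite /a invf_div.
have pow1 : c `^ (a * (a^-1 - 1)) * c `^ (a - 1) = 1.
  rewrite -powRD; last by rewrite (gt_eqF c0) implybT.
  by rewrite (_ : _ + _ = 0) ?powRr0//; field; rewrite gt_eqF.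
rewrite /= -/a at0 sE -powRrM.
rewrite [LHS](_ : _ = (a^-1 * a) *
  (c `^ (a * (a^-1 - 1)) * c `^ (a - 1)) * int01 h); last by ring.
by rewrite pow1 mulVf ?gt_eqF// !mul1r.
Qed.

End Aggregation.

(** * Symmetric paths *)

Lemma lag_perturb (R : realType) (x0 : R) (x : nat -> R) (t : nat) (s : R) tau :
  lag x0 (perturb t x s) tau = if tau == t.+1 then x t + s else lag x0 x tau.
Proof. by case: tau => [//|tau] /=; rewrite /perturb eqSS; case: eqP => [->|]. Qed.

Lemma perturbE (R : realType) (x : nat -> R) (t : nat) (s : R) :
  perturb t x s t = x t + s.
Proof. by rewrite /perturb eqxx. Qed.

Lemma perturb_neq (R : realType) (x : nat -> R) (t tau : nat) (s : R) :
  tau != t -> perturb t x s tau = x tau.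
Proof. by rewrite /perturb => /negbTE ->. Qed.

(** Removes the shift in the exponent, so that [field] can treat the remaining real power as an
    atom. *)
Lemma powR_subr1 (R : realType) (y a : R) : 0 < y -> y `^ (a - 1) = y `^ a / y.
Proof.
move=> y0; rewrite powRB; last by rewrite (gt_eqF y0) implybT.
by rewrite powRr1// ltW.
Qed.

Lemma powR_div (R : realType) (a b r : R) : 0 <= a -> 0 <= b ->
  (a / b) `^ r = a `^ r / b `^ r.
Proof.
by move=> a0 b0; rewrite powRM ?invr_ge0// -powR_inv1// powRAC powR_inv1 ?powR_ge0.
Qed.

Lemma is_derive_fpowR_log (R : realType) (f : R -> R) (y df a : R) :
  0 < f y -> is_derive y (1 : R) f df ->
  is_derive y (1 : R) (fun z => f z `^ a) (a * (f y `^ a / f y) * df).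
Proof. by move=> f0 ?; rewrite -powR_subr1//; exact: is_derive_fpowR. Qed.

(** Profile of the derivatives of the dated Lagrangian terms with respect to a choice made at [t]:
    [d0] at its own date, and [d1] at the next date, where bonds and perceived costs reappear as
    lagged values. *)
Definition dated (R : realType) (t : nat) (d0 d1 : R) (tau : nat) : R :=
  if tau == t then d0 else if tau == t.+1 then d1 else 0.

Lemma is_derive_dated (R : realType) (L : nat -> R -> R) (t : nat) (d0 d1 : R) tau :
  is_derive (0 : R) (1 : R) (L t) d0 -> is_derive (0 : R) (1 : R) (L t.+1) d1 ->
  (forall r, r != t -> r != t.+1 -> forall s, L r s = L r 0) ->
  is_derive (0 : R) (1 : R) (L tau) (dated t d0 d1 tau).
Proof.
move=> L0 L1 Lc; rewrite /dated.
have [->//|nt] := eqVneq tau t; have [->//|nt1] := eqVneq tau t.+1.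
rewrite (_ : L tau = fun=> L tau 0); first exact: is_derive_fcst.
by apply/funext => s; exact: Lc.
Qed.

Lemma is_derive_dated_static (R : realType) (L : nat -> R -> R) (t : nat) (d0 : R)
    tau :
  is_derive (0 : R) (1 : R) (L t) d0 ->
  (forall r, r != t -> forall s, L r s = L r 0) ->
  is_derive (0 : R) (1 : R) (L tau) (dated t d0 0 tau).
Proof.
move=> L0 Lc; apply: is_derive_dated => //; last by move=> r nt _; exact: Lc.
rewrite (_ : L t.+1 = fun=> L t.+1 0); first exact: is_derive_fcst.
by apply/funext => s; apply: Lc; rewrite neq_ltn ltnSn orbT.
Qed.

(** One path [N] serves for labor supply and labor inputs, and one path [Y] for output and
    purchases: with unit masses of agents, market clearing equates the common values. No optimality
    condition is included, so the record serves both to analyze a given equilibrium and to construct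
    one. *)
Record symmetric_path (R : realType) (p : params R) (Mpbar : R)
    (x : trajectory R) (A P C Y N W : nat -> R) (C0 : R) : Prop := SymmetricPath {
  path_technology : forall j t, unit_itv j -> technology x j t = A t;
  path_price : forall j t, unit_itv j -> price x j t = P t;
  path_cost : forall j t, unit_itv j -> perceived_cost x j t = C t;
  path_cost_init : forall j, unit_itv j -> perceived_cost_init x j = C0;
  path_output : forall j t, unit_itv j -> output x j t = Y t;
  path_labor_input : forall j k t, unit_itv j -> unit_itv k ->
    labor_input x j k t = N t;
  path_purchases : forall j k t, unit_itv j -> unit_itv k ->
    purchases x j k t = Y t;
  path_labor : forall k t, unit_itv k -> labor x k t = N t;
  path_wage : forall k t, unit_itv k -> wage x k t = W t;
  path_gt0 : forall t, [/\ 0 < A t, 0 < P t & 0 < C t] /\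
    [/\ 0 < Y t, 0 < N t, 0 < W t & 0 < fairness p Mpbar (P t / C t)];
  path_cost_init_gt0 : 0 < C0;
  path_perception : forall t, next_perceived_cost p (lag C0 C t) (P t) = C t }.

Section PathQuantities.
Context {R : realType} (p : params R) (Mpbar : R) (A P C Y N W : nat -> R).

Definition path_fairness t : R := fairness p Mpbar (P t / C t).

Definition path_elasticity t : R := theta p * (P t / C t) / path_fairness t.

(** Along a symmetric path the product of price index and consumption index is
    [(P / F) * (F * Y) = P * Y], so fairness drops out of the stochastic discount factor. *)
Definition path_discount t : R := delta p ^+ t * (P 0 * Y 0) / (P t * Y t).

Definition path_marginal_cost t : R :=
  W t / (alpha p * A t * N t `^ (alpha p - 1)).

(* The multipliers that solve the first-order conditions: of the budget
   constraint, of the demand for labor services, of the demand for goods and of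
   the law of motion of perceived costs; the multiplier of the production
   function is the marginal cost. *)
Definition budget_multiplier t : R := 1 / (Y t * P t).

Definition labor_multiplier t : R := budget_multiplier t * W t / nu p.

Definition demand_multiplier t : R := P t - path_marginal_cost t.

Definition perception_multiplier t : R :=
  P t / ((1 - gamma p) * C t) *
  (demand_multiplier t * (Y t / P t *
     (epsilon p + (epsilon p - 1) * gamma p * path_elasticity t)) - Y t).

(* The first-order conditions after elimination of the multipliers. *)
Definition wage_setting t : Prop :=
  N t `^ eta p = (nu p - 1) / nu p * (W t / (P t * Y t)).

Definition consumption_euler (Q : nat -> R) t : Prop :=
  Q t * budget_multiplier t = delta p * budget_multiplier t.+1.

Definition price_setting t : Prop :=
  path_discount t * perception_multiplier t = path_discount t.+1 *
    (demand_multiplier t.+1 *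
       ((epsilon p - 1) * gamma p * path_elasticity t.+1 * Y t.+1 / C t)
     + perception_multiplier t.+1 * (gamma p * C t.+1 / C t)).

End PathQuantities.

(** * Aggregates, demand and derivatives of the Lagrangians along a symmetric path *)

Section SymmetricPath.
Context {R : realType} {p : params R} (hp : admissible p) {Mpbar : R}.
Context {x : trajectory R} {A P C Y N W : nat -> R} {C0 : R}.
Hypothesis sp : symmetric_path p Mpbar x A P C Y N W C0.

Let eps1 : 1 < epsilon p. Proof. by case: hp => -[]. Qed.
Let nu1 : 1 < nu p. Proof. by case: hp => -[]. Qed.
Let eps0 : 0 < epsilon p. Proof. exact: lt_trans ltr01 eps1. Qed.
Let nu0 : 0 < nu p. Proof. exact: lt_trans ltr01 nu1. Qed.
Let eta1 : 0 < 1 + eta p. Proof. by case: hp => _ [? _ _ _ _]; rewrite addr_gt0. Qed.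

Lemma fair_ratio_gt0 : 0 < fair_ratio p.
Proof. by rewrite /fair_ratio divr_gt0// subr_gt0. Qed.

Local Notation F := (path_fairness p Mpbar P C).
Local Notation phi := (path_elasticity p Mpbar P C).
Local Notation Gam := (path_discount p P Y).

Let P0 t : 0 < P t. Proof. by case: (path_gt0 sp t) => -[]. Qed.
Let Cgt0 t : 0 < C t. Proof. by case: (path_gt0 sp t) => -[]. Qed.
Let Y0 t : 0 < Y t. Proof. by case: (path_gt0 sp t) => _ []. Qed.
Let N0 t : 0 < N t. Proof. by case: (path_gt0 sp t) => _ []. Qed.
Let W0 t : 0 < W t. Proof. by case: (path_gt0 sp t) => _ []. Qed.
Let F0 t : 0 < F t. Proof. by case: (path_gt0 sp t) => _ []. Qed.

Lemma path_lag_cost j t : unit_itv j ->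
  lag (perceived_cost_init x j) (perceived_cost x j) t = lag C0 C t.
Proof.
move=> jj; case: t => [|t] /=; first exact: (path_cost_init sp jj).
exact: (path_cost sp).
Qed.

Lemma path_lag_cost_gt0 t : 0 < lag C0 C t.
Proof. by case: t => [|t] //=; exact: (path_cost_init_gt0 sp). Qed.

Lemma path_fairness_factor j t : unit_itv j -> fairness_factor p Mpbar x j t = F t.
Proof.
move=> jj; rewrite /fairness_factor /perceived_markup.
by rewrite (path_price sp)// (path_cost sp).
Qed.

Lemma path_consumption_index k t : unit_itv k ->
  consumption_index p Mpbar x (fun j => purchases x j k) t = F t * Y t.
Proof.
move=> kk; apply: ces_cst => //; first by rewrite mulr_ge0// ltW.
by move=> j jj; rewrite path_fairness_factor// (path_purchases sp).
Qed.

Lemma path_aggregate_consumption t : aggregate_consumption p Mpbar x t = F t * Y t.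
Proof. by apply: int01_cst => k kk; exact: path_consumption_index. Qed.

Lemma path_price_index t : price_index p Mpbar x t = P t / F t.
Proof.
apply: ces_price_cst => //; first by rewrite divr_ge0// ltW.
by move=> j jj; rewrite path_fairness_factor// (path_price sp).
Qed.

Lemma path_wage_index t : wage_index p x t = W t.
Proof.
by apply: ces_price_cst => // [|k kk]; [exact: ltW|exact: (path_wage sp)].
Qed.

Lemma path_firm_employment j t : unit_itv j -> firm_employment p x j t = N t.
Proof.
by move=> jj; apply: ces_cst => // [|k kk]; [exact: ltW|exact: (path_labor_input sp)].
Qed.

Lemma path_total_employment t : int01 (fun j => firm_employment p x j t) = N t.
Proof. by apply: int01_cst => j jj; exact: path_firm_employment. Qed.

Lemma path_employment t : employment x t = N t.
Proof. by apply: int01_cst => k kk; exact: (path_labor sp). Qed.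

Lemma path_discount_factor t : discount_factor p Mpbar x t = Gam t.
Proof.
rewrite /discount_factor !path_price_index !path_aggregate_consumption /path_discount.
by field; rewrite !gt_eqF.
Qed.

Lemma path_markup j t : unit_itv j ->
  markup p x j t = P t / (W t / (alpha p * A t * N t `^ (alpha p - 1))).
Proof.
move=> jj; rewrite /markup /marginal_cost path_wage_index path_firm_employment//.
by rewrite (path_price sp)// (path_technology sp).
Qed.

Lemma path_labor_demand t w :
  labor_demand p x t w = (w / W t) `^ (- nu p) * N t.
Proof. by rewrite /labor_demand path_wage_index path_total_employment. Qed.

Lemma path_labor_demandE t : labor_demand p x t (W t) = N t.
Proof. by rewrite path_labor_demand mulfV ?gt_eqF// powR1 mul1r. Qed.



(** Substituting the law of motion of [C t] into [P t / C t] leaves exactly the argument of fairness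
    in the demand curve, which is expressed with the past perceived cost. *)
Lemma path_perceived_markup t :
  fair_ratio p `^ (1 - gamma p) * (P t / lag C0 C t) `^ gamma p = P t / C t.
Proof.
have r0 := fair_ratio_gt0; have c0 := path_lag_cost_gt0 t; have Pt0 := P0 t.
rewrite -(path_perception sp t) /next_perceived_cost (mulrC _^-1).
rewrite (@powR_div _ (P t) (lag C0 C t)) ?ltW// (@powR_div _ (P t) (fair_ratio p)) ?ltW//.
rewrite (@powRB _ (P t)); last by rewrite (gt_eqF Pt0) implybT.
by rewrite (powRr1 (ltW Pt0)); field; rewrite !gt_eqF ?powR_gt0.
Qed.

Lemma path_goods_demand t (z c : R) : goods_demand p Mpbar x t z c =
  F t * Y t * (z / (P t / F t)) `^ (- epsilon p) *
  fairness p Mpbar (fair_ratio p `^ (1 - gamma p) * (z / c) `^ gamma p)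
    `^ (epsilon p - 1).
Proof. by rewrite /goods_demand path_aggregate_consumption path_price_index. Qed.

(** The relative price is [F t], and the exponents of [F t] sum to
    [1 - epsilon + (epsilon - 1) = 0]. *)
Lemma path_goods_demandE t : goods_demand p Mpbar x t (P t) (lag C0 C t) = Y t.
Proof.
rewrite path_goods_demand path_perceived_markup -/(path_fairness p Mpbar P C t).
rewrite (_ : P t / (P t / F t) = F t); last by field; rewrite !gt_eqF.
by rewrite powRN powR_subr1//; field; rewrite !gt_eqF ?powR_gt0.
Qed.



Lemma is_derive_fairness (f : R -> R) (y df : R) : is_derive y (1 : R) f df ->
  is_derive y (1 : R) (fun z => fairness p Mpbar (f z)) (- (theta p * df)).
Proof.
move=> df_; rewrite /fairness; eapply is_derive_eq.
  eapply (is_derive_fD (is_derive_fcst _ _)); eapply is_derive_fN.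
  eapply (is_derive_fM (is_derive_fcst _ _)).
  exact: (is_derive_fD df_ (is_derive_fcst _ _)).
by rewrite mulr0 !addr0 add0r.
Qed.

(** Price and past perceived cost vary together so that one computation covers both firm conditions.
    The direct price elasticity is [- epsilon]; through fairness, the perceived markup responds to
    [z / c] with elasticity [gamma], fairness to it with [- phi], and demand to fairness with
    [epsilon - 1]. *)
Lemma is_derive_goods_demand t (z c : R -> R) (dz dc : R) :
  z 0 = P t -> c 0 = lag C0 C t ->
  is_derive (0 : R) (1 : R) z dz -> is_derive (0 : R) (1 : R) c dc ->
  is_derive (0 : R) (1 : R) (fun s => goods_demand p Mpbar x t (z s) (c s))
    (Y t * ((epsilon p - 1) * gamma p * phi t * (dc / lag C0 C t - dz / P t)
            - epsilon p * (dz / P t))).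
Proof.
move=> z0 c0 dz_ dc_.
have r0 := fair_ratio_gt0; have lc0 := path_lag_cost_gt0 t; have Pt0 := P0 t.
have Mp := path_perceived_markup t.
have PF : P t / (P t / F t) = F t by field; rewrite !gt_eqF.
(* Logarithmic derivative of the ratio [z / c] at 0. *)
pose dr := dz / P t - dc / lag C0 C t.
pose m s := fair_ratio p `^ (1 - gamma p) * (z s / c s) `^ gamma p.
have m0 : m 0 = P t / C t by rewrite /m z0 c0.
have dq : is_derive (0 : R) (1 : R) (fun s => z s / c s) (P t / lag C0 C t * dr).
  eapply is_derive_eq.
    eapply (is_derive_fM dz_); eapply is_derive_fV; [|exact: dc_].
    by rewrite c0 gt_eqF.
  by rewrite /= z0 c0 /dr; field; rewrite !gt_eqF.
have dm : is_derive (0 : R) (1 : R) m (P t / C t * gamma p * dr).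
  eapply is_derive_eq.
    eapply (is_derive_fM (is_derive_fcst _ _)); eapply is_derive_fpowR_log; [|exact: dq].
    by rewrite z0 c0 divr_gt0.
  by rewrite /= -Mp z0 c0; field; rewrite !gt_eqF ?powR_gt0.
have dF : is_derive (0 : R) (1 : R) (fun s => fairness p Mpbar (m s))
    (- (gamma p * phi t * F t * dr)).
  eapply is_derive_eq; [exact: (is_derive_fairness dm)|].
  by rewrite /path_elasticity; field; rewrite !gt_eqF.
have dp : is_derive (0 : R) (1 : R) (fun s => z s / (P t / F t)) (F t * (dz / P t)).
  eapply is_derive_eq; [exact: (is_derive_fM dz_ (is_derive_fcst _ _))|].
  by rewrite mulr0 add0r; field; rewrite !gt_eqF.
have Fm0 : fairness p Mpbar (m 0) = F t by rewrite m0.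
rewrite (_ : (fun s => _) = fun s => F t * Y t * (z s / (P t / F t)) `^ (- epsilon p)
    * fairness p Mpbar (m s) `^ (epsilon p - 1)); last first.
  by apply/funext => s; rewrite path_goods_demand.
eapply is_derive_eq.
  eapply is_derive_fM.
    eapply (is_derive_fM (is_derive_fcst _ _)).
    eapply is_derive_fpowR_log; [|exact: dp].
    by rewrite z0 PF.
  eapply is_derive_fpowR_log; [|exact: dF].
  by rewrite Fm0.
rewrite /= z0 PF Fm0 powRN powR_subr1// /dr.
by field; rewrite !gt_eqF ?powR_gt0.
Qed.

(** Fairness multiplies both the consumption index and its derivative, hence cancels in the
    derivative of the logarithm. *)
Lemma is_derive_household_purchases k a b (h : R -> R) t tau :
  unit_itv k -> direction h ->
  is_derive (0 : R) (1 : R) (fun s => household_lagrangian p Mpbar x k a b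
    (HouseholdPlan (fun j => perturb t (purchases x j k) (s * h j))
       (labor x k) (wage x k) (bonds x k)) tau)
  (dated t (delta p ^+ t * (int01 h / Y t - a t * (P t * int01 h))) 0 tau).
Proof.
move=> kk dh; pose L r s := household_lagrangian p Mpbar x k a b
    (HouseholdPlan (fun j => perturb t (purchases x j k) (s * h j))
       (labor x k) (wage x k) (bonds x k)) r.
rewrite -[f in is_derive _ _ f _]/(L tau).
apply: is_derive_dated_static => [|r nt s]; last first.
  have K z : L r z = household_lagrangian p Mpbar x k a b (plan_of_household x k) r.
    rewrite /L /household_lagrangian /budget_surplus /consumption_index /=.
    under eq_ces do rewrite perturb_neq//.
    by under eq_int01 do rewrite perturb_neq//.
  by rewrite !K.
have FY0 : 0 < F t * Y t by rewrite mulr_gt0.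
have dC : is_derive (0 : R) (1 : R)
    (fun s => consumption_index p Mpbar x
      (fun j => perturb t (purchases x j k) (s * h j)) t) (F t * int01 h).
  rewrite (_ : (fun s => _) =
      fun s => ces (epsilon p) (fun j => F t * Y t + s * (F t * h j))).
    by rewrite -int01Z//; apply: is_derive_ces => //; exact: directionZ.
  apply/funext => s; apply: eq_ces => j jj.
  by rewrite path_fairness_factor// perturbE (path_purchases sp)//; ring.
have dB : is_derive (0 : R) (1 : R)
    (fun s => int01 (fun j => price x j t * perturb t (purchases x j k) (s * h j) t))
    (P t * int01 h).
  rewrite (_ : (fun s => _) = fun s => P t * Y t + s * (P t * int01 h)).
    by eapply is_derive_eq; [repeat derive_step|rewrite /=; ring].
  apply/funext => s; rewrite -int01Z// -int01_affine; last exact: directionZ.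
  apply: eq_int01 => j jj.
  by rewrite (path_price sp)// perturbE (path_purchases sp)//=; ring.
have C0E : consumption_index p Mpbar x
    (fun j => perturb t (purchases x j k) (0 * h j)) t = F t * Y t.
  apply: ces_cst => //; first exact: ltW.
  move=> j jj; rewrite path_fairness_factor// perturbE (path_purchases sp)//.
  by rewrite mul0r addr0.
rewrite /L /household_lagrangian /budget_surplus /=; eapply is_derive_eq.
  repeat derive_step.
  by rewrite C0E.
by rewrite /= C0E; field; rewrite !gt_eqF.
Qed.

Lemma is_derive_household_labor k a b t tau : unit_itv k ->
  is_derive (0 : R) (1 : R) (fun s => household_lagrangian p Mpbar x k a b
    (HouseholdPlan (fun j => purchases x j k) (perturb t (labor x k) s)
       (wage x k) (bonds x k)) tau)
  (dated t (delta p ^+ t * (a t * W t - N t `^ eta p - b t)) 0 tau).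
Proof.
move=> kk; pose L r s := household_lagrangian p Mpbar x k a b
    (HouseholdPlan (fun j => purchases x j k) (perturb t (labor x k) s)
       (wage x k) (bonds x k)) r.
rewrite -[f in is_derive _ _ f _]/(L tau).
apply: is_derive_dated_static => [|r nt s]; last first.
  by rewrite /L /household_lagrangian /budget_surplus /= !perturb_neq.
rewrite /L /household_lagrangian /budget_surplus /=.
under eq_fun do rewrite perturbE (path_labor sp)// (path_wage sp)//.
eapply is_derive_eq.
  repeat derive_step.
  by rewrite addr0.
rewrite /= addr0 (addrC 1) addrK; field.
by rewrite addrC gt_eqF.
Qed.

(** A single household leaves the wage index and firms' employment unchanged, so the demand for its
    labor has elasticity [- nu] in its own wage. *)
Lemma is_derive_household_wage k a b t tau : unit_itv k ->
  is_derive (0 : R) (1 : R) (fun s => household_lagrangian p Mpbar x k a b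
    (HouseholdPlan (fun j => purchases x j k) (labor x k)
       (perturb t (wage x k) s) (bonds x k)) tau)
  (dated t (delta p ^+ t * (a t * N t - b t * (nu p * N t / W t))) 0 tau).
Proof.
move=> kk; pose L r s := household_lagrangian p Mpbar x k a b
    (HouseholdPlan (fun j => purchases x j k) (labor x k)
       (perturb t (wage x k) s) (bonds x k)) r.
rewrite -[f in is_derive _ _ f _]/(L tau).
apply: is_derive_dated_static => [|r nt s]; last first.
  by rewrite /L /household_lagrangian /budget_surplus /= !perturb_neq.
rewrite /L /household_lagrangian /budget_surplus /=.
under eq_fun do rewrite perturbE path_labor_demand (path_labor sp)// (path_wage sp)//.
have WW : (W t + 0) / W t = 1 by rewrite addr0 mulfV// gt_eqF.
eapply is_derive_eq.
  repeat derive_step.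
  by rewrite WW.
by rewrite /= WW powR1; field; rewrite !gt_eqF.
Qed.

(** A bond costs [bond_price x t] in the budget of date [t] and pays one unit in that of date
    [t.+1]. *)
Lemma is_derive_household_bonds k a b t tau :
  is_derive (0 : R) (1 : R) (fun s => household_lagrangian p Mpbar x k a b
    (HouseholdPlan (fun j => purchases x j k) (labor x k)
       (wage x k) (perturb t (bonds x k) s)) tau)
  (dated t (delta p ^+ t * - (a t * bond_price x t))
     (delta p ^+ t.+1 * a t.+1) tau).
Proof.
pose L r s := household_lagrangian p Mpbar x k a b
    (HouseholdPlan (fun j => purchases x j k) (labor x k)
       (wage x k) (perturb t (bonds x k) s)) r.
rewrite -[f in is_derive _ _ f _]/(L tau).
apply: is_derive_dated => [||r nt nt1 s].
- rewrite /L /household_lagrangian /budget_surplus /=.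
  under eq_fun do rewrite perturbE lag_perturb [t == _]ltn_eqF//.
  by eapply is_derive_eq; [repeat derive_step|rewrite /=; ring].
- rewrite /L /household_lagrangian /budget_surplus /=.
  under eq_fun do rewrite perturbE perturb_neq ?gtn_eqF//.
  by eapply is_derive_eq; [repeat derive_step|rewrite /=; ring].
- rewrite /L /household_lagrangian /budget_surplus /= !lag_perturb.
  by rewrite (negbTE nt1) !perturb_neq.
Qed.

Lemma is_derive_next_perceived_cost t (z c : R -> R) (dz dc : R) :
  z 0 = P t -> c 0 = lag C0 C t ->
  is_derive (0 : R) (1 : R) z dz -> is_derive (0 : R) (1 : R) c dc ->
  is_derive (0 : R) (1 : R) (fun s => next_perceived_cost p (c s) (z s))
    (C t * (gamma p * (dc / lag C0 C t) + (1 - gamma p) * (dz / P t))).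
Proof.
move=> z0 c0 dz_ dc_; have r0 := fair_ratio_gt0.
have lc0 := path_lag_cost_gt0 t; have Pt0 := P0 t.
have dq : is_derive (0 : R) (1 : R) (fun s => (fair_ratio p)^-1 * z s)
    ((fair_ratio p)^-1 * dz).
  by eapply is_derive_eq; [repeat derive_step|rewrite mulr0 addr0].
rewrite /next_perceived_cost; eapply is_derive_eq.
  eapply is_derive_fM.
    by eapply is_derive_fpowR_log; [rewrite c0|exact: dc_].
  by eapply is_derive_fpowR_log; [rewrite z0 mulr_gt0 ?invr_gt0|exact: dq].
rewrite /= z0 c0 -(path_perception sp t) /next_perceived_cost.
by field; rewrite !gt_eqF.
Qed.

Lemma is_derive_firm_output j md my mc t tau : unit_itv j ->
  is_derive (0 : R) (1 : R) (fun s => firm_lagrangian p Mpbar x j md my mc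
    (FirmPlan (perturb t (output x j) s) (price x j) (labor_input x j)
       (perceived_cost x j)) tau)
  (dated t (Gam t * (P t - md t - my t)) 0 tau).
Proof.
move=> jj; pose L r s := firm_lagrangian p Mpbar x j md my mc
    (FirmPlan (perturb t (output x j) s) (price x j) (labor_input x j)
       (perceived_cost x j)) r.
rewrite -[f in is_derive _ _ f _]/(L tau).
apply: is_derive_dated_static => [|r nt s]; last first.
  by rewrite /L /firm_lagrangian /firm_demand_gap /firm_production_gap
    /firm_perception_gap /= !perturb_neq.
rewrite /L /firm_lagrangian /firm_demand_gap /firm_production_gap
  /firm_perception_gap /=.
under eq_fun do rewrite path_discount_factor perturbE (path_price sp)//.
by eapply is_derive_eq; [repeat derive_step|rewrite /=; ring].
Qed.

Lemma is_derive_firm_price j md my mc t tau : unit_itv j ->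
  is_derive (0 : R) (1 : R) (fun s => firm_lagrangian p Mpbar x j md my mc
    (FirmPlan (output x j) (perturb t (price x j) s) (labor_input x j)
       (perceived_cost x j)) tau)
  (dated t (Gam t * (Y t
     - md t * (Y t / P t * (epsilon p + (epsilon p - 1) * gamma p * phi t))
     + mc t * ((1 - gamma p) * C t / P t))) 0 tau).
Proof.
move=> jj; pose L r s := firm_lagrangian p Mpbar x j md my mc
    (FirmPlan (output x j) (perturb t (price x j) s) (labor_input x j)
       (perceived_cost x j)) r.
rewrite -[f in is_derive _ _ f _]/(L tau).
apply: is_derive_dated_static => [|r nt s]; last first.
  by rewrite /L /firm_lagrangian /firm_demand_gap /firm_production_gap
    /firm_perception_gap /= !perturb_neq.
rewrite /L /firm_lagrangian /firm_demand_gap /firm_production_gap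
  /firm_perception_gap /=.
under eq_fun do rewrite path_discount_factor perturbE (path_price sp)//
  (path_lag_cost _ jj) (path_output sp)//.
have Pt0 := P0 t; have lc0 := path_lag_cost_gt0 t; have z0 : P t + 0 = P t by rewrite addr0.
have dP : is_derive (0 : R) (1 : R) (fun s => P t + s) 1.
  by eapply is_derive_eq; [repeat derive_step|rewrite add0r].
have dG := is_derive_goods_demand z0 erefl dP (is_derive_fcst _ _).
have dN := is_derive_next_perceived_cost z0 erefl dP (is_derive_fcst _ _).
by eapply is_derive_eq; [repeat derive_step|rewrite /=; field; rewrite !gt_eqF].
Qed.

Lemma is_derive_firm_labor_input j md my mc (h : R -> R) t tau :
  unit_itv j -> direction h ->
  is_derive (0 : R) (1 : R) (fun s => firm_lagrangian p Mpbar x j md my mc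
    (FirmPlan (output x j) (price x j)
       (fun k => perturb t (labor_input x j k) (s * h k))
       (perceived_cost x j)) tau)
  (dated t (Gam t * ((my t * (alpha p * A t * N t `^ (alpha p - 1)) - W t)
     * int01 h)) 0 tau).
Proof.
move=> jj dh; pose L r s := firm_lagrangian p Mpbar x j md my mc
    (FirmPlan (output x j) (price x j)
       (fun k => perturb t (labor_input x j k) (s * h k))
       (perceived_cost x j)) r.
rewrite -[f in is_derive _ _ f _]/(L tau).
apply: is_derive_dated_static => [|r nt s]; last first.
  have K z : L r z = firm_lagrangian p Mpbar x j md my mc (plan_of_firm x j) r.
    rewrite /L /firm_lagrangian /firm_production_gap /=.
    under eq_ces do rewrite perturb_neq//.
    by under eq_int01 do rewrite perturb_neq//.
  by rewrite !K.
rewrite /L /firm_lagrangian /firm_demand_gap /firm_production_gap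
  /firm_perception_gap /=.
under eq_fun do rewrite path_discount_factor (path_technology sp)//.
have dC : is_derive (0 : R) (1 : R)
    (fun s => ces (nu p) (fun k => perturb t (labor_input x j k) (s * h k) t))
    (int01 h).
  rewrite (_ : (fun s => _) = fun s => ces (nu p) (fun k => N t + s * h k)).
    exact: is_derive_ces.
  apply/funext => s; apply: eq_ces => k kk.
  by rewrite perturbE (path_labor_input sp).
have dB : is_derive (0 : R) (1 : R)
    (fun s => int01 (fun k => wage x k t * perturb t (labor_input x j k) (s * h k) t))
    (W t * int01 h).
  rewrite (_ : (fun s => _) = fun s => W t * N t + s * (W t * int01 h)).
    by eapply is_derive_eq; [repeat derive_step|rewrite /=; ring].
  apply/funext => s; rewrite -int01Z// -int01_affine; last exact: directionZ.
  apply: eq_int01 => k kk.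
  by rewrite (path_wage sp)// perturbE (path_labor_input sp)//=; ring.
have C0E : ces (nu p) (fun k => perturb t (labor_input x j k) (0 * h k) t) = N t.
  apply: ces_cst => //; first exact: ltW.
  by move=> k kk; rewrite perturbE (path_labor_input sp)// mul0r addr0.
eapply is_derive_eq.
  repeat derive_step.
  by rewrite C0E.
by rewrite /= C0E; ring.
Qed.

(** This is the intertemporal link of the pricing problem: the perceived cost of date [t] shifts
    demand at [t.+1] and is inherited by the perceived cost of [t.+1]. *)
Lemma is_derive_firm_cost j md my mc t tau : unit_itv j ->
  is_derive (0 : R) (1 : R) (fun s => firm_lagrangian p Mpbar x j md my mc
    (FirmPlan (output x j) (price x j) (labor_input x j)
       (perturb t (perceived_cost x j) s)) tau)
  (dated t (- (Gam t * mc t))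
     (Gam t.+1 *
       (md t.+1 * ((epsilon p - 1) * gamma p * phi t.+1 * Y t.+1 / C t)
        + mc t.+1 * (gamma p * C t.+1 / C t))) tau).
Proof.
move=> jj; pose L r s := firm_lagrangian p Mpbar x j md my mc
    (FirmPlan (output x j) (price x j) (labor_input x j)
       (perturb t (perceived_cost x j) s)) r.
rewrite -[f in is_derive _ _ f _]/(L tau).
apply: is_derive_dated => [||r nt nt1 s].
- rewrite /L /firm_lagrangian /firm_demand_gap /firm_production_gap
    /firm_perception_gap /=.
  under eq_fun do rewrite perturbE lag_perturb [t == _]ltn_eqF// path_discount_factor.
  by eapply is_derive_eq; [repeat derive_step|rewrite /=; ring].
- rewrite /L /firm_lagrangian /firm_demand_gap /firm_production_gap
    /firm_perception_gap /=.
  under eq_fun do rewrite perturbE perturb_neq ?gtn_eqF// path_discount_factor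
    (path_price sp)// (path_cost sp)//.
  have Ct0 := Cgt0 t; have c0 : C t + 0 = lag C0 C t.+1 by rewrite addr0.
  have dC : is_derive (0 : R) (1 : R) (fun s => C t + s) 1.
    by eapply is_derive_eq; [repeat derive_step|rewrite add0r].
  have dG := is_derive_goods_demand erefl c0 (is_derive_fcst _ _) dC.
  have dN := is_derive_next_perceived_cost erefl c0 (is_derive_fcst _ _) dC.
  have := P0 t.+1; have := Cgt0 t.+1 => C10 P10.
  by eapply is_derive_eq; [repeat derive_step|rewrite /=; field; rewrite !gt_eqF].
- rewrite /L /firm_lagrangian /firm_demand_gap /firm_production_gap
    /firm_perception_gap /= !lag_perturb.
  by rewrite (negbTE nt1) !perturb_neq.
Qed.

End SymmetricPath.

(** * Means of the multipliers *)

Section FirstOrderConditions.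
Context {R : realType} {d : measure_display} {Om : measurableType d}.
Context (P : probability Om R) {Ft : nat -> set (set Om)}.
Hypothesis hFt : filtration Ft.

Lemma filtration_setT t : Ft t setT.
Proof. by have [/(_ t) [G0 GD _] _ _] := hFt; have := GD _ G0; rewrite setD0. Qed.

Lemma filtration_set0 t : Ft t set0.
Proof. by have [/(_ t) []] := hFt. Qed.

Lemma measurable_wrt_cst t (c : R) : measurable_wrt (Ft t) (fun=> c : R).
Proof.
move=> B _; rewrite preimage_cst; case: ifP => _.
  exact: filtration_setT.
exact: filtration_set0.
Qed.

(** Integrability is carried along with the mean. Multipliers in an equilibrium are only known to be
    adapted; their integrability is recovered from that of the first-order conditions, which are
    affine in them. *)
Definition has_mean (X : Om -> R) (m : R) : Prop :=
  P.-integrable setT (EFin \o X) /\ \int[P]_om X om = m.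

Lemma has_mean_cst c : has_mean (fun=> c) c.
Proof.
split; first exact: finite_measure_integrable_cst.
rewrite Rintegral_cst// (_ : fine _ = 1) ?mulr1//.
exact: (congr1 fine (probability_setT P)).
Qed.

Lemma has_meanD X Y m n : has_mean X m -> has_mean Y n ->
  has_mean (fun om => X om + Y om) (m + n).
Proof.
move=> [iX <-] [iY <-]; split; last by rewrite RintegralD.
by rewrite (_ : _ \o _ = (EFin \o X) \+ (EFin \o Y))%E//; exact: integrableD.
Qed.

Lemma has_meanZ c X m : has_mean X m -> has_mean (fun om => c * X om) (c * m).
Proof.
move=> [iX <-]; split; last by rewrite RintegralZl.
rewrite (_ : _ \o _ = fun om => c%:E * (EFin \o X) om)%E//.
exact: integrableZl.
Qed.

Lemma has_mean_ext X Y m : X =1 Y -> has_mean X m -> has_mean Y m.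
Proof. by move=> /funext ->. Qed.

Lemma has_mean_unique X m n : has_mean X m -> has_mean X n -> m = n.
Proof. by move=> [_ <-] [_ <-]. Qed.

Lemma sum_dated T t (d0 d1 : R) : (t.+1 < T)%N ->
  \sum_(tau < T) dated t d0 d1 tau = d0 + d1.
Proof.
move=> tT; have tT' := ltnW tT; rewrite (bigD1 (Ordinal tT'))//=.
rewrite (bigD1 (Ordinal tT))//=; last by rewrite -val_eqE /= gtn_eqF.
rewrite big1 ?addr0; last first.
  move=> i; rewrite -!val_eqE /= /dated => /andP[/negbTE-> /negbTE->] //.
by rewrite /dated !eqxx gtn_eqF.
Qed.

(** The whole space belongs to [Ft t]; testing the conditional expectation on it gives an
    unconditional mean, and uniqueness of derivatives identifies the integrand. *)
Lemma first_order_condition_mean t (L : Om -> nat -> R -> R) (d0 d1 : Om -> R) :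
  first_order_condition P Ft t L ->
  (forall om tau, is_derive (0 : R) (1 : R) (L om tau)
     (dated t (d0 om) (d1 om) tau)) ->
  has_mean (fun om => d0 om + d1 om) 0.
Proof.
move=> [D [dD cD]] dL.
have DE om tau : D om tau = dated t (d0 om) (d1 om) tau.
  by have [_ <-] := dD om tau; have [_ <-] := dL om tau.
(* The shortest admissible partial sum, with dates [t] and [t.+1] as its last two terms. *)
have := cD t.+2 (ltnSn _).
have -> : (fun om => \sum_(tau < t.+2) D om tau) = fun om => d0 om + d1 om.
  by apply/funext => om; rewrite -(@sum_dated t.+2 t)//; exact: eq_bigr.
move=> [iX _ _ /(_ _ (filtration_setT t)) XE]; split => //.
by rewrite /Rintegral XE integral0.
Qed.

(** The converse direction needs no averaging: the condition holds exactly in every state, and 0 is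
    its own conditional expectation. *)
Lemma first_order_condition_zero t (L : Om -> nat -> R -> R) (d0 d1 : Om -> R) :
  (forall om tau, is_derive (0 : R) (1 : R) (L om tau)
     (dated t (d0 om) (d1 om) tau)) ->
  (forall om, d0 om + d1 om = 0) ->
  first_order_condition P Ft t L.
Proof.
move=> dL d00; exists (fun om => dated t (d0 om) (d1 om)); split => // T tT.
rewrite (_ : (fun om => _) = cst 0); last first.
  by apply/funext => om; rewrite sum_dated.
by split => //; [exact: finite_measure_integrable_cst..|exact: measurable_wrt_cst].
Qed.

Variables (p : params R) (hp : admissible p) (Mpbar : R).
Variables (e : Om -> trajectory R) (A Pr C Y N W : nat -> R) (C0 : R).
Hypothesis sp : forall om, symmetric_path p Mpbar (e om) A Pr C Y N W C0.

Let nu1 : 1 < nu p. Proof. by case: hp => -[]. Qed.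
Let nu0 : 0 < nu p. Proof. exact: lt_trans ltr01 nu1. Qed.
Let gamma1 : 0 < 1 - gamma p.
Proof. by case: hp => -[_ _ /andP[_ ?] _ _]; rewrite subr_gt0. Qed.
Let delta0 t : 0 < delta p ^+ t.
Proof. by case: hp => -[_ _ _ /andP[? _]] _; rewrite exprn_gt0. Qed.
Let alpha0 : 0 < alpha p. Proof. by case: hp => _ [_ /andP[]]. Qed.
(** The paths do not depend on the state, but their positivity is inherited from [sp], which is
    indexed by one; hence the argument [om]. *)
Let A0 (om : Om) t : 0 < A t. Proof. by case: (path_gt0 (sp om) t) => -[]. Qed.
Let P0 (om : Om) t : 0 < Pr t. Proof. by case: (path_gt0 (sp om) t) => -[]. Qed.
Let Cgt0 (om : Om) t : 0 < C t. Proof. by case: (path_gt0 (sp om) t) => -[]. Qed.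
Let Y0 (om : Om) t : 0 < Y t. Proof. by case: (path_gt0 (sp om) t) => _ []. Qed.
Let N0 (om : Om) t : 0 < N t. Proof. by case: (path_gt0 (sp om) t) => _ []. Qed.
Let W0 (om : Om) t : 0 < W t. Proof. by case: (path_gt0 (sp om) t) => _ []. Qed.

Local Notation Gam := (path_discount p Pr Y).
Local Notation phi := (path_elasticity p Mpbar Pr C).
Local Notation mc := (path_marginal_cost p A N W).
Local Notation am := (budget_multiplier Pr Y).
Local Notation bm := (labor_multiplier p Pr Y W).
Local Notation dm := (demand_multiplier p A Pr N W).
Local Notation cm := (perception_multiplier p Mpbar A Pr C Y N W).

Let Gam0 (om : Om) t : 0 < Gam t.
Proof. by rewrite /path_discount !(divr_gt0, mulr_gt0) ?P0 ?Y0. Qed.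
Let mpl0 (om : Om) t : 0 < alpha p * A t * N t `^ (alpha p - 1).
Proof. by rewrite !mulr_gt0 ?A0// powR_gt0 ?N0. Qed.

Let unit0 := @unit_itv0 R.

Lemma int01_one : int01 (fun=> 1 : R) = 1.
Proof. exact: int01_cst. Qed.

(** * Household conditions in an equilibrium *)

Section HouseholdNecessary.
Variables (q : nat -> R) (a b : Om -> nat -> R).
Hypothesis qE : forall om t, bond_price (e om) t = q t.
Hypothesis foc : household_focs p Mpbar P Ft e 0 a b.
Variable om0 : Om.

Lemma budget_multiplier_mean t : has_mean (a^~ t) (am t).
Proof.
have [/(_ _ (direction_cst 1)) F _ _ _] := foc t.
have := first_order_condition_mean F (fun om tau =>
  is_derive_household_purchases hp (sp om) (a om) (b om) t tau unit0 (direction_cst 1)).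
(* This scaling turns the condition into [a t - am t]; adding the constant [am t] then isolates the
   multiplier. *)
rewrite int01_one => /(has_meanZ (- (delta p ^+ t * Pr t)^-1)).
move=> /(has_meanD (has_mean_cst (am t))); rewrite mulr0 addr0.
apply: has_mean_ext => om; rewrite /budget_multiplier.
by field; rewrite !gt_eqF ?P0 ?Y0.
Qed.

Lemma wage_setting_necessary t : wage_setting p Pr Y N W t.
Proof.
have [_ F1 F2 _] := foc t; have ma := budget_multiplier_mean t.
have := first_order_condition_mean F1 (fun om tau =>
  is_derive_household_labor hp (sp om) (a om) (b om) t tau unit0).
have := first_order_condition_mean F2 (fun om tau =>
  is_derive_household_wage hp (sp om) (a om) (b om) t tau unit0).
have Wt := W0 om0 t; have Nt := N0 om0 t.
(* The labor and wage conditions are scaled so that [b] cancels in their sum state by state; what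
   remains is affine in [a], whose mean is known. *)
move=> /(has_meanZ (- (delta p ^+ t * (nu p * N t / W t))^-1)) h2.
move=> /(has_meanZ (delta p ^+ t)^-1) /has_meanD /(_ h2) {h2}.
rewrite !mulr0 addr0 => h0.
have := has_meanD (has_mean_cst (- N t `^ eta p)) (has_meanZ (W t * (1 - (nu p)^-1)) ma).
move=> /has_mean_unique /(_ (has_mean_ext _ h0)) h.
rewrite /wage_setting; apply/eqP; rewrite -subr_eq0; apply/eqP.
rewrite -[RHS]oppr0 -h => [|om]; last by field; rewrite !gt_eqF.
by rewrite /budget_multiplier; field; rewrite !gt_eqF ?P0 ?Y0.
Qed.

Lemma consumption_euler_necessary t : consumption_euler p Pr Y q t.
Proof.
have [_ _ _ F] := foc t; have ma := budget_multiplier_mean.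
have := first_order_condition_mean F (fun om tau =>
  is_derive_household_bonds 0 (a om) (b om) t tau).
move=> h0; have := has_meanD (has_meanZ (delta p ^+ t * - q t) (ma t))
  (has_meanZ (delta p ^+ t.+1) (ma t.+1)).
move=> /has_mean_unique /(_ (has_mean_ext _ h0)) h.
rewrite /consumption_euler; apply/eqP; rewrite -subr_eq0.
rewrite -(mulrI_eq0 _ (lregP (lt0r_neq0 (delta0 t)))) -oppr_eq0; apply/eqP.
by rewrite -h => [|om]; rewrite ?qE exprS; ring.
Qed.

End HouseholdNecessary.

(** * Firm conditions in an equilibrium *)

Section FirmNecessary.
Variables (md my mk : Om -> nat -> R).
Hypothesis foc : firm_focs p Mpbar P Ft e 0 md my mk.
Variable om0 : Om.

(** The firm's conditions are triangular in the multipliers: labor input determines the mean of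
    [my], output then that of [md], price that of [mk], and the condition on perceived cost is left
    as the price-setting equation. *)
Lemma production_multiplier_mean t : has_mean (my^~ t) (mc t).
Proof.
have [_ _ /(_ _ (direction_cst 1)) F _] := foc t.
have := first_order_condition_mean F (fun om tau =>
  is_derive_firm_labor_input hp (sp om) (md om) (my om) (mk om) t tau unit0
    (direction_cst 1)).
have G0 := Gam0 om0 t; have M0 := mpl0 om0 t.
rewrite int01_one => /(has_meanZ (Gam t * (alpha p * A t * N t `^ (alpha p - 1)))^-1).
move=> /(has_meanD (has_mean_cst (mc t))); rewrite mulr0 addr0.
apply: has_mean_ext => om; rewrite /path_marginal_cost.
by field; rewrite !gt_eqF ?powR_gt0 ?A0 ?N0.
Qed.

Lemma demand_multiplier_mean t : has_mean (md^~ t) (dm t).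
Proof.
have [F _ _ _] := foc t.
have := first_order_condition_mean F (fun om tau =>
  is_derive_firm_output hp (sp om) (md om) (my om) (mk om) t tau unit0).
have G0 := Gam0 om0 t.
move=> /(has_meanZ (- (Gam t)^-1)) /has_meanD.
move=> /(_ _ _ (has_meanZ (-1) (production_multiplier_mean t))).
move=> /(has_meanD (has_mean_cst (Pr t))); rewrite mulr0 add0r mulN1r.
by apply: has_mean_ext => om; field; rewrite gt_eqF.
Qed.

Lemma perception_multiplier_mean t : has_mean (mk^~ t) (cm t).
Proof.
have [_ F _ _] := foc t.
have := first_order_condition_mean F (fun om tau =>
  is_derive_firm_price hp (sp om) (md om) (my om) (mk om) t tau unit0).
have G0 := Gam0 om0 t; have Pt := P0 om0 t; have Ct := Cgt0 om0 t.
move=> /(has_meanZ (Pr t / (Gam t * ((1 - gamma p) * C t)))) /has_meanD.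
set E := Y t / Pr t * (epsilon p + (epsilon p - 1) * gamma p * phi t).
move=> /(_ _ _ (has_meanZ (Pr t / ((1 - gamma p) * C t))
  (has_meanD (has_meanZ E (demand_multiplier_mean t)) (has_mean_cst (- Y t))))).
rewrite mulr0 add0r (mulrC E).
by apply: has_mean_ext => om; field; rewrite !gt_eqF.
Qed.

Lemma price_setting_necessary t : price_setting p Mpbar A Pr C Y N W t.
Proof.
have [_ _ _ F] := foc t.
have mm := perception_multiplier_mean; have mdm := demand_multiplier_mean t.+1.
have := first_order_condition_mean F (fun om tau =>
  is_derive_firm_cost hp (sp om) (md om) (my om) (mk om) t tau unit0).
set k1 := _ * Y t.+1 / C t; set k2 := gamma p * C t.+1 / C t => h0.
have := has_meanD (has_meanZ (- Gam t) (mm t)) (has_meanZ (Gam t.+1)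
  (has_meanD (has_meanZ k1 mdm) (has_meanZ k2 (mm t.+1)))).
move=> /has_mean_unique /(_ (has_mean_ext _ h0)) h.
rewrite /price_setting; apply/eqP; rewrite eq_sym -subr_eq0; apply/eqP.
by rewrite -h => [|om]; rewrite -?/k1 -?/k2; ring.
Qed.

End FirmNecessary.

(** * Deterministic multipliers satisfying all first-order conditions *)

Section Sufficient.
Hypothesis wageE : forall t, wage_setting p Pr Y N W t.

Lemma household_focs_sufficient (q : nat -> R) k : unit_itv k ->
  (forall om t, bond_price (e om) t = q t) ->
  (forall t, consumption_euler p Pr Y q t) ->
  household_focs p Mpbar P Ft e k (fun=> am) (fun=> bm).
Proof.
move=> kk qE eulerE plan L t; split.
- move=> h dh; refine (first_order_condition_zero (fun om tau =>
    is_derive_household_purchases hp (sp om) am bm t tau kk dh) _) => om.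
  by rewrite /budget_multiplier; field; rewrite !gt_eqF ?P0 ?Y0.
- refine (first_order_condition_zero (fun om tau =>
    is_derive_household_labor hp (sp om) am bm t tau kk) _) => om.
  rewrite wageE /labor_multiplier /budget_multiplier.
  by field; rewrite !gt_eqF ?P0 ?Y0.
- refine (first_order_condition_zero (fun om tau =>
    is_derive_household_wage hp (sp om) am bm t tau kk) _) => om.
  by rewrite /labor_multiplier; field; rewrite !gt_eqF ?W0.
- refine (first_order_condition_zero (fun om tau =>
    is_derive_household_bonds k am bm t tau) _) => om.
  by rewrite qE (mulrC (am t)) eulerE exprS; ring.
Qed.

Lemma firm_focs_sufficient j : unit_itv j ->
  (forall t, price_setting p Mpbar A Pr C Y N W t) ->
  firm_focs p Mpbar P Ft e j (fun=> dm) (fun=> mc) (fun=> cm).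
Proof.
move=> jj priceE plan L t; split.
- refine (first_order_condition_zero (fun om tau =>
    is_derive_firm_output hp (sp om) dm mc cm t tau jj) _) => om.
  by rewrite /demand_multiplier; ring.
- refine (first_order_condition_zero (fun om tau =>
    is_derive_firm_price hp (sp om) dm mc cm t tau jj) _) => om.
  have Pt := P0 om t; have Ct := Cgt0 om t; rewrite /perception_multiplier.
  by field; rewrite !gt_eqF.
- move=> h dh; refine (first_order_condition_zero (fun om tau =>
    is_derive_firm_labor_input hp (sp om) dm mc cm t tau jj dh) _) => om.
  rewrite /path_marginal_cost.
  by field; rewrite !gt_eqF ?powR_gt0 ?A0 ?N0.
- refine (first_order_condition_zero (fun om tau =>
    is_derive_firm_cost hp (sp om) dm mc cm t tau jj) _) => om.
  by rewrite (priceE t) addNr.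
Qed.

End Sufficient.

End FirstOrderConditions.

(** * Steady states *)

Section ParameterBounds.
Context {R : realType} (p : params R) (hp : admissible p).

Lemma epsilon_gt1 : 1 < epsilon p. Proof. by case: hp => -[]. Qed.
Lemma nu_gt1 : 1 < nu p. Proof. by case: hp => -[]. Qed.
Lemma gamma_gt0 : 0 < gamma p. Proof. by case: hp => -[_ _ /andP[]]. Qed.
Lemma gamma_lt1 : 0 < 1 - gamma p.
Proof. by case: hp => -[_ _ /andP[_ ?] _ _]; rewrite subr_gt0. Qed.
Lemma delta_gt0 : 0 < delta p. Proof. by case: hp => -[_ _ _ /andP[]]. Qed.
Lemma delta_lt1 : 0 < 1 - delta p.
Proof. by case: hp => -[_ _ _ /andP[_ ?]] _; rewrite subr_gt0. Qed.
Lemma delta_gamma_lt1 : 0 < 1 - delta p * gamma p.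
Proof. have := gamma_gt0; have := gamma_lt1; have := delta_gt0; have := delta_lt1; nra. Qed.
Lemma alpha_gt0 : 0 < alpha p. Proof. by case: hp => _ [_ /andP[]]. Qed.
Lemma theta_gt0 : 0 < theta p. Proof. by case: hp => _ []. Qed.
Lemma chi_le1 : 0 <= 1 - chi p.
Proof. by case: hp => _ [_ _ _ _ /andP[_ ?]]; rewrite subr_ge0. Qed.
Lemma psi_gt1 : 1 < psi p. Proof. by case: hp => _ []. Qed.
Lemma eta_gt0 : 0 < eta p. Proof. by case: hp => _ []. Qed.

End ParameterBounds.

(** * The scalar equations at constant inflation *)

Section SteadyStateAlgebra.
Context {R : realType} (p : params R) (hp : admissible p).
Implicit Types pi : R.

Let eps1 := epsilon_gt1 hp.
Let nu1 := nu_gt1 hp.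
Let gamma0 := gamma_gt0 hp.
Let gamma1 := gamma_lt1 hp.
Let delta0 := delta_gt0 hp.
Let delta1 := delta_lt1 hp.
Let dg1 := delta_gamma_lt1 hp.
Let alpha0 := alpha_gt0 hp.
Let theta0 := theta_gt0 hp.
Let eta0 := eta_gt0 hp.
Let eps10 : 0 < epsilon p - 1. Proof. by rewrite subr_gt0. Qed.
Let eps0 : 0 < epsilon p. Proof. exact: lt_trans ltr01 eps1. Qed.

Lemma ss_perceived_markup_gt0 pi : 0 < ss_perceived_markup p pi.
Proof. by rewrite /ss_perceived_markup mulr_gt0 ?expR_gt0 ?divr_gt0. Qed.

(** In logarithms both sides are linear equations in [ln z], equivalent because [1 - gamma] is
    nonzero; this is where the exponent [gamma / (1 - gamma) * pi] of the perceived markup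
    arises. *)
Lemma next_perceived_cost_growth (c z pi : R) : 0 < c -> 0 < z ->
  next_perceived_cost p c z = c * expR pi <->
  z / (c * expR pi) = ss_perceived_markup p pi.
Proof.
move=> c0 z0; have r0 : 0 < fair_ratio p := fair_ratio_gt0 hp.
have e0 := expR_gt0 pi.
have ln_next : ln (next_perceived_cost p c z) =
    gamma p * ln c + (1 - gamma p) * (ln z - ln (fair_ratio p)).
  rewrite lnM ?posrE ?powR_gt0 ?mulr_gt0 ?invr_gt0// !ln_powR.
  by rewrite lnM ?posrE ?invr_gt0// lnV ?posrE// (addrC (- _)).
have ln_cg : ln (c * expR pi) = ln c + pi by rewrite lnM ?posrE// expRK.
have ln_Mp : ln (z / (c * expR pi)) = ln z - ln c - pi.
  by rewrite lnM ?posrE ?invr_gt0 ?mulr_gt0// lnV ?posrE ?mulr_gt0// ln_cg opprD addrA.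
have ln_ss : ln (ss_perceived_markup p pi) =
    ln (fair_ratio p) + gamma p / (1 - gamma p) * pi.
  by rewrite lnM ?posrE ?expR_gt0// expRK.
split=> h.
  apply: ln_inj; rewrite ?posrE ?ss_perceived_markup_gt0 ?divr_gt0 ?mulr_gt0//.
  have := congr1 (@ln R) h; rewrite ln_next ln_cg => h'; rewrite ln_Mp ln_ss.
  have -> : ln z = ln c + pi / (1 - gamma p) + ln (fair_ratio p).
    apply: (mulfI (lt0r_neq0 gamma1)); rewrite !mulrDr (mulrC _ (pi / _)).
    by rewrite divfK ?gt_eqF//; lra.
  by field; rewrite gt_eqF.
apply: ln_inj; rewrite ?posrE ?mulr_gt0 ?powR_gt0 ?mulr_gt0 ?invr_gt0//.
have := congr1 (@ln R) h; rewrite ln_Mp ln_ss => h'; rewrite ln_next ln_cg.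
have -> : ln z = ln c + pi + (ln (fair_ratio p) + gamma p / (1 - gamma p) * pi).
  by rewrite -h'; ring.
by field; rewrite gt_eqF.
Qed.

Lemma fairness_steady pi : fairness p (ss_perceived_markup p pi)
  (ss_perceived_markup p pi) = ss_fairness p pi.
Proof. by rewrite /fairness /fair_markup /fair_ratio /ss_fairness; ring. Qed.

Lemma fairness_elasticityE (Mb M : R) : 0 < M -> 0 < fairness p Mb M ->
  fairness_elasticity p Mb M = theta p * M / fairness p Mb M.
Proof.
move=> M0 F0; rewrite /fairness_elasticity derive1E.
have lM : expR (ln M) = M by rewrite lnK.
have dF : is_derive (ln M) (1 : R) (fun m : R => fairness p Mb (expR m))
    (- (theta p * (expR (ln M) * 1))).
  exact: (is_derive_fairness (is_derive_fexpR (is_derive_fid _))).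
have dl : is_derive (ln M) (1 : R) (fun m : R => ln (fairness p Mb (expR m)))
    (- (theta p * M / fairness p Mb M)).
  eapply is_derive_eq.
    by eapply is_derive_fln; [rewrite lM|exact: dF].
  by rewrite /= lM; field; rewrite gt_eqF.
by rewrite (derive_val (is_derive := dl)) opprK.
Qed.

Lemma ss_elasticity_gt0 pi : 0 < ss_fairness p pi -> 0 < ss_elasticity p pi.
Proof.
by move=> F0; have Mp0 := ss_perceived_markup_gt0 pi; rewrite divr_gt0// mulr_gt0.
Qed.

(** The quantity [kappa] of the price-setting equation. *)
Definition adjusted_elasticity pi : R :=
  (1 - delta p) * gamma p / (1 - delta p * gamma p) * ss_elasticity p pi.

Lemma adjusted_elasticity_gt0 pi : 0 < ss_fairness p pi ->
  0 < adjusted_elasticity pi.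
Proof. by move=> F0; rewrite mulr_gt0 ?ss_elasticity_gt0// divr_gt0 ?mulr_gt0. Qed.

Lemma ss_markupE pi :
  ss_markup p pi = 1 + 1 / (epsilon p - 1) * (1 / (1 + adjusted_elasticity pi)).
Proof. by []. Qed.

Lemma ss_markup_gt1 pi : 0 < ss_fairness p pi -> 1 < ss_markup p pi.
Proof.
move=> F0; rewrite ss_markupE ltrDl mulr_gt0 ?divr_gt0// addr_gt0//.
exact: adjusted_elasticity_gt0.
Qed.

Lemma ss_employment_gt0 pi : 0 < ss_fairness p pi -> 0 < ss_employment p pi.
Proof.
move=> F0; rewrite powR_gt0// mulr_gt0 ?divr_gt0 ?mulr_gt0 ?subr_gt0//.
  exact: lt_trans ltr01 nu1.
exact: lt_trans ltr01 (ss_markup_gt1 F0).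
Qed.

(** Higher inflation raises the perceived markup strictly and lowers fairness weakly (fairness is
    constant under full acclimation, [chi = 1]). Their ratio, the elasticity, therefore rises
    strictly, which lowers the markup and raises employment. *)
Lemma ss_monotone pi1 pi2 : 0 < ss_fairness p pi1 -> 0 < ss_fairness p pi2 ->
  pi1 < pi2 ->
  ss_markup p pi2 < ss_markup p pi1 /\ ss_employment p pi1 < ss_employment p pi2.
Proof.
move=> F1 F2 lt12; have nu0 : 0 < nu p := lt_trans ltr01 nu1.
have ltMp : ss_perceived_markup p pi1 < ss_perceived_markup p pi2.
  by rewrite ltr_pM2l ?divr_gt0// ltr_expR ltr_pM2l// divr_gt0.
have leF : ss_fairness p pi2 <= ss_fairness p pi1.
  rewrite lerD2l lerN2 ler_wpM2l ?lerD2r ?(ltW ltMp)//.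
  by rewrite mulr_ge0 ?(ltW theta0)// chi_le1.
have Mp1 := ss_perceived_markup_gt0 pi1.
have ltphi : ss_elasticity p pi1 < ss_elasticity p pi2.
  apply: (@le_lt_trans _ _ (theta p * ss_perceived_markup p pi1 / ss_fairness p pi2)).
    by rewrite /ss_elasticity ler_pM2l; [rewrite lef_pV2 ?posrE|exact: mulr_gt0].
  by rewrite ltr_pM2r ?invr_gt0// ltr_pM2l.
have ltadj : adjusted_elasticity pi1 < adjusted_elasticity pi2.
  by rewrite ltr_pM2l// divr_gt0 ?mulr_gt0.
have a1 := adjusted_elasticity_gt0 F1.
have ltM : ss_markup p pi2 < ss_markup p pi1.
  rewrite !ss_markupE ltrD2l ltr_pM2l ?divr_gt0// !div1r ltf_pV2 ?posrE; lra.
have M2 := ss_markup_gt1 F2; have M1 := ss_markup_gt1 F1.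
split=> //; apply: gt0_ltr_powR.
- by rewrite divr_gt0// addr_gt0.
- by rewrite nnegrE ltW// !mulr_gt0 ?invr_gt0 ?subr_gt0//; lra.
- by rewrite nnegrE ltW// !mulr_gt0 ?invr_gt0 ?subr_gt0//; lra.
- rewrite ltr_pM2l ?divr_gt0 ?mulr_gt0 ?subr_gt0// !div1r ltf_pV2 ?posrE; lra.
Qed.

(** At constant growth the inflation factors of the discount factor and of the nominal variables
    cancel, so the intertemporal condition becomes a static one on the markup. *)
Lemma price_setting_markup pi (Mb : R) (A P C Y N W : nat -> R) t :
  [/\ 0 < A t, 0 < P t, 0 < C t, 0 < Y t & 0 < N t] -> 0 < W t -> 0 < P 0 -> 0 < Y 0 ->
  [/\ A t.+1 = A t, Y t.+1 = Y t & N t.+1 = N t] ->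
  [/\ P t.+1 = P t * expR pi, C t.+1 = C t * expR pi & W t.+1 = W t * expR pi] ->
  0 < ss_fairness p pi -> path_elasticity p Mb P C t = ss_elasticity p pi ->
  price_setting p Mb A P C Y N W t <->
  P t / path_marginal_cost p A N W t = ss_markup p pi.
Proof.
move=> [A0 P0 C0 Y0 N0] W0 P00 Y00 [AE YE NE] [PE CE WE] F0 phiE.
have e0 := expR_gt0 pi; set m := path_marginal_cost p A N W t.
have mpl0 : 0 < alpha p * A t * N t `^ (alpha p - 1) by rewrite !mulr_gt0 ?powR_gt0.
have m0 : 0 < m by rewrite divr_gt0.
have mE : path_marginal_cost p A N W t.+1 = m * expR pi.
  by rewrite /m /path_marginal_cost AE NE WE; ring.
have phi1E : path_elasticity p Mb P C t.+1 = ss_elasticity p pi.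
  rewrite -phiE /path_elasticity /path_fairness PE CE.
  by rewrite -mulf_div divff ?gt_eqF// mulr1.
have phi0 := ss_elasticity_gt0 F0; have a0 := adjusted_elasticity_gt0 F0.
have d0 : 0 < delta p ^+ t by rewrite exprn_gt0.
set phi := ss_elasticity p pi in phiE phi1E phi0.
(* [D] is the Lerner index and [E] the effective price elasticity of demand; the condition to reach
   is the inverse-elasticity rule [D * E = 1]. *)
pose D := 1 - m / P t.
pose E := epsilon p + (epsilon p - 1) * adjusted_elasticity pi.
have E0 : 0 < E by rewrite addr_gt0// mulr_gt0.
have gap : path_discount p P Y t * perception_multiplier p Mb A P C Y N W t -
    path_discount p P Y t.+1 *
    (demand_multiplier p A P N W t.+1 *
       ((epsilon p - 1) * gamma p * path_elasticity p Mb P C t.+1 * Y t.+1 / C t)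
     + perception_multiplier p Mb A P C Y N W t.+1 * (gamma p * C t.+1 / C t))
  = delta p ^+ t * (P 0 * Y 0) * (1 - delta p * gamma p) / ((1 - gamma p) * C t)
    * (D * E - 1).
  rewrite /perception_multiplier /demand_multiplier mE phiE phi1E /path_discount.
  rewrite PE CE YE -/m exprS /E /D /adjusted_elasticity -/phi.
  by field; rewrite !gt_eqF.
have k0 : delta p ^+ t * (P 0 * Y 0) * (1 - delta p * gamma p) /
    ((1 - gamma p) * C t) != 0.
  by rewrite gt_eqF// divr_gt0 ?mulr_gt0.
have mark : ss_markup p pi = E / (E - 1).
  have E1 : E - 1 = (epsilon p - 1) * (1 + adjusted_elasticity pi) by rewrite /E; ring.
  rewrite E1 ss_markupE /E; field.
  by rewrite !gt_eqF// addr_gt0.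
have E1 : 0 < E - 1 by rewrite /E addrAC addr_gt0// mulr_gt0.
rewrite /price_setting mark; split.
  move/eqP; rewrite -subr_eq0 gap mulf_eq0 (negbTE k0) /= subr_eq0 => /eqP DE.
  have {}DE : D = E^-1 by rewrite -[LHS](mulfK (lt0r_neq0 E0)) DE mul1r.
  rewrite -[LHS]invf_div (_ : m / P t = 1 - D); last by rewrite /D; ring.
  by rewrite DE; field; rewrite !gt_eqF.
move=> PmE; apply/eqP; rewrite -subr_eq0 gap mulf_eq0 subr_eq0; apply/orP; right.
have -> : D = 1 - (P t / m)^-1 by rewrite /D invf_div.
by rewrite PmE; apply/eqP; field; rewrite !gt_eqF.
Qed.

(** The markup fixes the labor share, [W N / (P Y) = alpha / M]. Multiplying the wage-setting
    equation by [N t] thus gives a constant value for [N t] to the power [1 + eta]. *)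
Lemma wage_setting_employment pi (A P Y N W : nat -> R) t :
  [/\ 0 < A t, 0 < P t, 0 < N t & 0 < W t] -> 0 < ss_fairness p pi ->
  Y t = A t * N t `^ alpha p ->
  P t / path_marginal_cost p A N W t = ss_markup p pi ->
  wage_setting p P Y N W t <-> N t = ss_employment p pi.
Proof.
move=> [A0 P0 N0 W0] F0 YE ME; have nu0 : 0 < nu p := lt_trans ltr01 nu1.
have M0 : 0 < ss_markup p pi := lt_trans ltr01 (ss_markup_gt1 F0).
have Na0 := powR_gt0 (alpha p) N0.
have WE : W t = P t / ss_markup p pi * (alpha p * A t * N t `^ (alpha p - 1)).
  rewrite -ME /path_marginal_cost; field.
  by rewrite !gt_eqF ?powR_gt0.
have eta1 : 0 < 1 + eta p by rewrite addr_gt0.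
have NE : N t `^ (1 + eta p) = N t * N t `^ eta p.
  by rewrite powRD ?powRr1 ?ltW// (gt_eqF N0) implybT.
rewrite /wage_setting; have -> : (nu p - 1) / nu p * (W t / (P t * Y t)) =
    (nu p - 1) * alpha p / nu p * (1 / ss_markup p pi) / N t.
  rewrite WE YE powR_subr1//; field.
  by rewrite !gt_eqF.
set K := _ * (1 / _); have K0 : 0 < K.
  by rewrite mulr_gt0 ?divr_gt0 ?mulr_gt0 ?subr_gt0.
have KE : (ss_employment p pi) `^ (1 + eta p) = K.
  by rewrite /ss_employment -/K -powRrM div1r mulVf ?gt_eqF// powRr1// ltW.
split=> [h|h].
  have {}h : N t `^ (1 + eta p) = K by rewrite NE h; field; rewrite gt_eqF.
  by rewrite /ss_employment -/K -h -powRrM div1r mulfV ?gt_eqF// powRr1// ltW.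
by rewrite -KE -h NE; field; rewrite gt_eqF.
Qed.

Lemma consumption_euler_growth pi (P Y Q : nat -> R) t :
  0 < P t -> 0 < Y t -> Y t.+1 = Y t -> P t.+1 = P t * expR pi ->
  consumption_euler p P Y Q t <-> Q t = delta p * expR (- pi).
Proof.
move=> P0 Y0 YE PE; rewrite /consumption_euler /budget_multiplier YE PE expRN.
have e0 := expR_gt0 pi.
have -> : delta p * (1 / (Y t * (P t * expR pi))) =
    delta p * (expR pi)^-1 * (1 / (Y t * P t)) by field; rewrite !gt_eqF.
split=> [/mulIf -> //|-> //].
by rewrite gt_eqF// divr_gt0 ?mulr_gt0.
Qed.

End SteadyStateAlgebra.

(** Conclusions that mention no state, such as the value of inflation, are read off in some state; a
    space of total mass 1 provides one. *)
Lemma probability_inhabited (R : realType) (d : measure_display)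
  (Om : measurableType d) (P : probability Om R) : exists om : Om, True.
Proof.
apply: contrapT => /forallNP noOm; have := probability_setT P.
rewrite (_ : setT = set0) ?measure0; last first.
  by rewrite -subset0 => om _; apply: (noOm om).
by move/eqP; rewrite eq_sym onee_eq0.
Qed.

Section SteadyState.
Context {R : realType} (p : params R) (hp : admissible p).
Context {d : measure_display} {Om : measurableType d} (P : probability Om R).
Context (Ft : nat -> set (set Om)) (hFt : filtration Ft).

(** For variables with an initial value, [c] is the value at date -1, so the value of date [t] is
    the path at [t.+1]; wages have no initial value and are read at [t]. *)
Definition growth_path (c pi : R) (t : nat) : R := c * expR (pi * t%:R).

Lemma growth_pathS c pi t : growth_path c pi t.+1 = growth_path c pi t * expR pi.
Proof. by rewrite /growth_path -natr1 mulrDr mulr1 expRD mulrA. Qed.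

Lemma growth_path0 c pi : growth_path c pi 0 = c.
Proof. by rewrite /growth_path mulr0 expR0 mulr1. Qed.

Lemma growth_path_gt0 c pi t : 0 < c -> 0 < growth_path c pi t.
Proof. by move=> c0; rewrite mulr_gt0 ?expR_gt0. Qed.

Lemma lag_growth_path c pi t :
  lag c (fun t => growth_path c pi t.+1) t = growth_path c pi t.
Proof. by case: t => [|t] //=; rewrite growth_path0. Qed.

Lemma growth_inflation (x : trajectory R) c pi t : 0 < c ->
  (forall j t, unit_itv j -> price x j t = growth_path c pi t.+1) ->
  (forall j, unit_itv j -> price_init x j = c) -> inflation x t = pi.
Proof.
move=> c0 pE iE; rewrite /inflation.
have -> : price_level x t = growth_path c pi t.+1.
  by apply: int01_cst => j jj; exact: pE.
have -> : lag_price_level x t = growth_path c pi t.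
  apply: int01_cst => j jj; case: t => [|t] /=; last exact: pE.
  by rewrite growth_path0 iE.
have -> : growth_path c pi t.+1 / growth_path c pi t = expR pi.
  by rewrite growth_pathS; field; rewrite gt_eqF ?growth_path_gt0.
exact: expRK.
Qed.

(** * Every steady-state equilibrium has the closed forms *)

Section Necessary.
Variables (Abar i0bar pi Mpbar : R) (e : Om -> trajectory R).
Hypothesis eq_e : steady_state_equilibrium p P Ft Abar i0bar pi Mpbar e.

Let u0 := @unit_itv0 R.

(** The steady-state clauses supply constants common to all states, taken here at index 0; symmetry
    carries them to all indices, and market clearing identifies output with purchases and labor
    supply with labor inputs. *)
Lemma steady_state_path : exists pb cb wb y n : R,
  (forall om, symmetric_path p Mpbar (e om) (fun=> Abar)
    (fun t => growth_path pb pi t.+1) (fun t => growth_path cb pi t.+1)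
    (fun=> y) (fun=> n) (growth_path wb pi) cb) /\
  (forall om j, unit_itv j -> price_init (e om) j = pb).
Proof.
have [[_ each _ firms] [[techA _] [outs [labs purs]] nominal wages _]] := eq_e.
have [y yE] := outs _ u0; have [n nE] := labs _ u0.
have [[m mE] [c cE]] := purs _ _ u0 u0.
have [[pb pbE] [cb cbE]] := nominal _ u0; have [[wb wbE] _ _] := wages _ u0.
have PE om j : unit_itv j ->
    price (e om) j =1 (fun t => growth_path pb pi t.+1) /\ price_init (e om) j = pb.
  move=> jj; have [_ [sym _] _ _] := each om.
  have [[_ -> -> _ _] _] := sym j 0 jj u0; split=> [t|].
    by have := pbE om t.+1.
  by have := pbE om 0%N; rewrite /= mulr0 expR0 mulr1.
have CE om j : unit_itv j -> perceived_cost (e om) j =1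
    (fun t => growth_path cb pi t.+1) /\ perceived_cost_init (e om) j = cb.
  move=> jj; have [_ [sym _] _ _] := each om.
  have [[_ _ _ -> ->] _] := sym j 0 jj u0; split=> [t|].
    by have := cbE om t.+1.
  by have := cbE om 0%N; rewrite /= mulr0 expR0 mulr1.
exists pb, cb, wb, y, n; split; last by move=> om j jj; case: (PE om j jj).
move=> om; have [pos [sym1 [sym2 sym3]] [mkt1 mkt2 _ _] _] := each om.
have [_ pos1 pos2 pos3 _] := pos.
have purE j k t : unit_itv j -> unit_itv k -> purchases (e om) j k t = c.
  by move=> jj kk; have [_ ->] := sym3 j 0 k 0 jj u0 kk u0.
have inpE j k t : unit_itv j -> unit_itv k -> labor_input (e om) j k t = m.
  by move=> jj kk; have [-> _] := sym3 j 0 k 0 jj u0 kk u0.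
have yc : y = c.
  by rewrite -(yE om 0%N) (mkt1 _ _ u0); apply: int01_cst => k kk; exact: purE.
have nm : n = m.
  by rewrite -(nE om 0%N) (mkt2 _ _ u0); apply: int01_cst => j jj; exact: inpE.
split.
- by move=> j t jj; exact: techA.
- by move=> j t jj; have [-> _] := PE om j jj.
- by move=> j t jj; have [-> _] := CE om j jj.
- by move=> j jj; have [_ ->] := CE om j jj.
- by move=> j t jj; have [_ ->] := sym1 j 0 jj u0; exact: yE.
- by move=> j k t jj kk; rewrite inpE.
- by move=> j k t jj kk; rewrite purE.
- by move=> k t kk; have [-> _ _ _ _] := sym2 k 0 kk u0; exact: nE.
- by move=> k t kk; have [_ -> _ _ _] := sym2 k 0 kk u0; exact: wbE.
- move=> t; have [A0 P0 C0 Y0] := pos1 0 t u0.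
  rewrite /fairness_factor /perceived_markup.
  have [L0 W0] := pos3 0 t u0; move: A0 P0 C0 Y0 L0 W0.
  rewrite techA// (PE _ _ u0).1 (CE _ _ u0).1 yE nE wbE.
  by move=> *; split; split.
- by have [_] := pos2 _ u0; rewrite (CE _ _ u0).2.
- move=> t; have [fcon _] := firms _ u0; have [_ _ /eqP] := fcon om t.
  rewrite /firm_perception_gap /= subr_eq0 => /eqP.
  rewrite (PE _ _ u0).1 (CE _ _ u0).1 (CE _ _ u0).2 => <-; congr next_perceived_cost.
  by case: t => [//|t] /=; rewrite (CE _ _ u0).1.
Qed.

Lemma steady_state_closed_forms :
  pi = (- ln (delta p) - i0bar) / (psi p - 1) /\
  0 < ss_fairness p pi /\
  Mpbar = ss_perceived_markup p pi /\
  fairness p Mpbar Mpbar = ss_fairness p pi /\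
  fairness_elasticity p Mpbar Mpbar = ss_elasticity p pi /\
  (forall om j t, unit_itv j -> markup p (e om) j t = ss_markup p pi) /\
  (forall om t, employment (e om) t = ss_employment p pi).
Proof.
have [om0 _] := probability_inhabited P.
have [pb [cb [wb [y [n [sp pinit]]]]]] := steady_state_path.
have [[_ each hhs firms] [[_ i0E] _ _ _ markE]] := eq_e.
have [[A0 P0 C0] [y0 n0 W0 F0]] := path_gt0 (sp om0) 0%N.
have cb0 := path_cost_init_gt0 (sp om0).
have pb0 : 0 < pb.
  by have [[_ _ /(_ _ u0)[h _] _ _] _ _ _] := each om0; rewrite pinit in h.
have MpE : growth_path pb pi 1 / growth_path cb pi 1 = ss_perceived_markup p pi.
  rewrite (growth_pathS cb) growth_path0; apply/next_perceived_cost_growth => //.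
  by rewrite (path_perception (sp om0) 0%N) growth_pathS growth_path0.
have MpbarE : Mpbar = ss_perceived_markup p pi.
  rewrite -MpE -(markE _ u0 om0 0%N) /perceived_markup.
  by rewrite (path_price (sp om0))// (path_cost (sp om0)).
have FE := fairness_steady p pi.
have ssF0 : 0 < ss_fairness p pi by rewrite -FE -{1}MpbarE -MpE.
have phiE t : path_elasticity p Mpbar (fun t => growth_path pb pi t.+1)
    (fun t => growth_path cb pi t.+1) t = ss_elasticity p pi.
  have PC : growth_path pb pi t.+1 / growth_path cb pi t.+1 = ss_perceived_markup p pi.
    by rewrite -MpE /growth_path -!mulf_div !divff ?gt_eqF ?expR_gt0.
  by rewrite /path_elasticity /path_fairness PC MpbarE FE.
have [_ [md [my [mk [_ _ _ ffoc]]]]] := firms _ u0.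
have [fcon _] := firms _ u0.
have [_ _ [a [b [_ _ hfoc]]]] := hhs _ u0.
have ME t : growth_path pb pi t.+1 / path_marginal_cost p (fun=> Abar) (fun=> n)
    (growth_path wb pi) t = ss_markup p pi.
  have [[? ? ?] [? ? ? ?]] := path_gt0 (sp om0) t.
  apply (@price_setting_markup _ _ hp pi Mpbar (fun=> Abar)
     (fun t => growth_path pb pi t.+1) (fun t => growth_path cb pi t.+1) (fun=> y)
     (fun=> n) (growth_path wb pi) t) => //.
  - by split; rewrite ?growth_pathS.
  - exact: (price_setting_necessary hFt hp sp ffoc om0 t).
have yE : y = Abar * n `^ alpha p.
  have [_ /eqP h _] := fcon om0 0%N; move: h.
  rewrite /firm_production_gap subr_eq0 => /eqP.
  rewrite /= (path_technology (sp om0))// (path_output (sp om0))// => <-.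
  by rewrite -(path_firm_employment hp (sp om0) 0%N u0).
have qE om t : bond_price (e om) t =
    expR (- (i0bar + psi p * pi)).
  have [[q0 _ _ _ _] _ _ /(_ t)] := each om; have {}q0 := q0 t.
  rewrite /interest_rate i0E (growth_inflation t pb0 (path_price (sp om)) (pinit om)).
  move=> <-.
  by rewrite opprK lnK.
(* The Euler equation and the policy rule give two expressions of the bond price; equating their
   logarithms leaves a linear equation in [pi], solvable because [psi > 1]. *)
have piE : pi = (- ln (delta p) - i0bar) / (psi p - 1).
  have := consumption_euler_necessary hFt hp sp qE hfoc 0%N.
  move/(@consumption_euler_growth _ p pi (fun t => growth_path pb pi t.+1) _ _ 0%N
    P0 y0 erefl (growth_pathS _ _ _)).
  move/(congr1 (@ln R)); rewrite expRK lnM ?posrE ?expR_gt0 ?delta_gt0// expRK.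
  have := psi_gt1 hp; rewrite -subr_gt0 => psi0 h.
  apply: (mulIf (lt0r_neq0 psi0)); rewrite divfK ?gt_eqF//; lra.
split=> //; split=> //; split=> //; split; first by rewrite MpbarE.
split.
  rewrite MpbarE fairness_elasticityE ?FE//; exact: ss_perceived_markup_gt0.
split=> [om j t jj|om t].
  by rewrite (path_markup hp (sp om))// ME.
rewrite (path_employment (sp om)).
apply (@wage_setting_employment _ _ hp pi (fun=> Abar) (fun t => growth_path pb pi t.+1)
  (fun=> y) (fun=> n) (growth_path wb pi) 0%N) => //.
exact: (wage_setting_necessary hFt hp sp hfoc om0 0%N).
Qed.

End Necessary.

(** * A deterministic steady-state equilibrium at each rate with positive fairness *)

Section Existence.
Variables (Abar pi : R).
Hypotheses (A0 : 0 < Abar) (F0 : 0 < ss_fairness p pi).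

Let n := ss_employment p pi.
Let y := Abar * n `^ alpha p.
(** The price at date -1 is normalized to 1, so this initial perceived cost makes the perceived
    markup equal to its steady-state value. *)
Let cb := (ss_perceived_markup p pi)^-1.
(* Makes the markup equal to [ss_markup p pi]. *)
Let wb := expR pi / ss_markup p pi * (alpha p * Abar * n `^ (alpha p - 1)).

(** The policy intercept inverts the formula for steady-state inflation, the bond price comes from
    the Euler equation, no bonds are held, and dividends are profits, which balances the budgets. *)
Definition steady_trajectory : trajectory R := Trajectory
  (fun _ _ => Abar) (fun=> - ln (delta p) - (psi p - 1) * pi)
  (fun=> delta p * expR (- pi))
  (fun _ t => growth_path 1 pi t.+1) (fun=> 1)
  (fun _ t => growth_path cb pi t.+1) (fun=> cb)
  (fun _ _ => y) (fun _ _ _ => n) (fun _ _ _ => y)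
  (fun _ _ => n) (fun _ => growth_path wb pi) (fun _ _ => 0) (fun=> 0)
  (fun _ t => growth_path 1 pi t.+1 * y - growth_path wb pi t * n).

Local Notation x := steady_trajectory.
Local Notation Mp := (ss_perceived_markup p pi).
Local Notation Pr := (fun t => growth_path 1 pi t.+1).
Local Notation C := (fun t => growth_path cb pi t.+1).

Let n0 : 0 < n. Proof. exact: ss_employment_gt0. Qed.
Let y0 : 0 < y. Proof. exact: mulr_gt0 A0 (powR_gt0 _ n0). Qed.
Let cb0 : 0 < cb. Proof. by rewrite invr_gt0; exact: ss_perceived_markup_gt0. Qed.
Let M0 : 0 < ss_markup p pi. Proof. exact: lt_trans ltr01 (ss_markup_gt1 hp F0). Qed.
Let wb0 : 0 < wb.
Proof.
have a0 := alpha_gt0 hp; have k0 := powR_gt0 (alpha p - 1) n0.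
exact: mulr_gt0 (divr_gt0 (expR_gt0 pi) M0) (mulr_gt0 (mulr_gt0 a0 A0) k0).
Qed.

Let PC t : growth_path 1 pi t.+1 / growth_path cb pi t.+1 = Mp.
Proof.
have e0 := expR_gt0 (pi * t.+1%:R).
rewrite /growth_path /cb; field.
by rewrite !gt_eqF// ss_perceived_markup_gt0.
Qed.

Lemma steady_trajectory_path :
  symmetric_path p Mp x (fun=> Abar) Pr C (fun=> y) (fun=> n) (growth_path wb pi) cb.
Proof.
split=> //.
- move=> t; rewrite PC fairness_steady.
  by split; split=> //; exact: growth_path_gt0.
- move=> t; rewrite lag_growth_path (growth_pathS cb).
  apply (next_perceived_cost_growth hp); rewrite ?growth_path_gt0//.
  by rewrite -growth_pathS.
Qed.

Let markupE t :
  growth_path 1 pi t.+1 /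
    path_marginal_cost p (fun=> Abar) (fun=> n) (growth_path wb pi) t
  = ss_markup p pi.
Proof.
have ? := alpha_gt0 hp; have ? := expR_gt0 (pi * t%:R).
have ? : 0 < n `^ (alpha p - 1) by rewrite powR_gt0.
have ? := expR_gt0 pi.
rewrite growth_pathS /growth_path /path_marginal_cost /wb; field.
by rewrite !gt_eqF.
Qed.

Lemma steady_trajectory_equilibrium :
  steady_state_equilibrium p P Ft Abar (- ln (delta p) - (psi p - 1) * pi) pi Mp
    (fun=> x).
Proof.
have sp := steady_trajectory_path; have spO (om : Om) := sp.
have cstW (f : nat -> R) : adapted Ft (fun=> f).
  by move=> t; exact: measurable_wrt_cst.
have cst0 (c : R) : measurable_wrt (Ft 0%N) (fun=> c).
  exact: measurable_wrt_cst.
have wageE t : wage_setting p Pr (fun=> y) (fun=> n) (growth_path wb pi) t.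
  apply (@wage_setting_employment _ _ hp pi (fun=> Abar) Pr (fun=> y) (fun=> n)
    (growth_path wb pi) t) => //.
  by split; rewrite ?growth_path_gt0.
have eulerE t : consumption_euler p Pr (fun=> y) (fun=> delta p * expR (- pi)) t.
  apply/(@consumption_euler_growth _ p pi Pr _ _ t) => //.
    exact: growth_path_gt0.
  exact: growth_pathS.
have priceE t : price_setting p Mp (fun=> Abar) Pr C (fun=> y) (fun=> n)
    (growth_path wb pi) t.
  apply (@price_setting_markup _ _ hp pi Mp (fun=> Abar) Pr C (fun=> y) (fun=> n)
    (growth_path wb pi) t) => //.
  - by split; rewrite ?growth_path_gt0.
  - exact: growth_path_gt0.
  - exact: growth_path_gt0.
  - by split; exact: growth_pathS.
  - by rewrite /path_elasticity /path_fairness PC fairness_steady.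
split; last first.
  split.
  - by [].
  - by split; [|split] => *; [exists y|exists n|split; [exists n|exists y]].
  - move=> j _; split; [exists 1|exists cb] => om t; exact: lag_growth_path.
  - move=> k _; split; first by exists wb.
      by exists 0 => om t; rewrite mul0r; case: t.
    (* Prices are one period ahead of wages on their growth paths, hence the factor [expR pi] on
       revenue only. *)
    exists (expR pi * y - wb * n) => om t /=.
    by rewrite growth_pathS /growth_path; ring.
  - by move=> j _ om t; exact: PC.
split.
- split=> [||j _|k _|j k _ _]; do ? [exact: cstW|exact: cst0|split].
- move=> om; split.
  + split=> /=.
    * by move=> t; rewrite mulr_gt0 ?expR_gt0// delta_gt0.
    * move=> j t _; split; rewrite ?growth_path_gt0//.
      by rewrite /fairness_factor /perceived_markup /= PC fairness_steady.
    * by [].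
    * by move=> k t _; rewrite growth_path_gt0.
    * by [].
  + by [].
  + split=> [j t _|k t _|t|] /=; by rewrite (@int01_cst _ _ _ (fun _ _ => erefl)).
  + move=> t; rewrite (@growth_inflation x 1 pi t)// /interest_rate /=.
    rewrite lnM ?posrE ?expR_gt0 ?delta_gt0// expRK; ring.
- move=> k kk; split.
  + move=> om t; split; last first.
      by rewrite /= (path_labor_demandE hp sp).
    rewrite /budget_surplus /=.
    rewrite (@int01_cst _ _ (growth_path 1 pi t.+1 * y)) => [|//].
    have -> : lag 0 (fun=> 0) t = 0 :> R by case: t.
    ring.
  + rewrite /no_ponzi /=.
    rewrite (_ : (fun t : nat => _) = cst 0%E); last first.
      by apply/funext => t; under eq_integral do rewrite mulr0; rewrite integral0.
    by rewrite (cvg_limn_einf_sup (@cvg_cst _ _ _ _ _)).1.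
  + exists (fun=> budget_multiplier Pr (fun=> y)).
    exists (fun=> labor_multiplier p Pr (fun=> y) (growth_path wb pi)).
    split; [exact: cstW|exact: cstW|].
    exact: (household_focs_sufficient _ hFt hp spO wageE (q := fun=> delta p * expR (- pi))).
- move=> j jj; split.
  + move=> om t; split.
    * rewrite /firm_demand_gap /=.
      rewrite (path_goods_demandE hp sp t) subrr//.
    * rewrite /firm_production_gap /=.
      by rewrite (@ces_cst _ _ _ n) ?nu_gt1 ?(ltW n0)// subrr.
    * by rewrite /firm_perception_gap /= (path_perception sp) subrr.
  + exists (fun=> demand_multiplier p (fun=> Abar) Pr (fun=> n) (growth_path wb pi)).
    exists (fun=> path_marginal_cost p (fun=> Abar) (fun=> n) (growth_path wb pi)).
    exists (fun=> perception_multiplier p Mp (fun=> Abar) Pr C (fun=> y) (fun=> n)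
      (growth_path wb pi)).
    split; do ? exact: cstW.
    exact: (firm_focs_sufficient _ hFt hp spO jj priceE).
Qed.

Lemma steady_trajectory_employment t : employment x t = ss_employment p pi.
Proof. exact: (path_employment steady_trajectory_path). Qed.

End Existence.

End SteadyState.

(** Without inflation the perceived markup is at most [epsilon / (epsilon - 1)], so the term
    subtracted from 1 is nonpositive. This supplies points of the Phillips curve for all admissible
    parameters. *)
Lemma ss_fairness_gt0_le0 (R : realType) (p : params R) (pi : R) :
  admissible p -> pi <= 0 -> 0 < ss_fairness p pi.
Proof.
move=> hp pi0; rewrite /ss_fairness subr_gt0 (@le_lt_trans _ _ 0)//.
rewrite mulr_ge0_le0//; first by rewrite mulr_ge0 ?chi_le1// ltW// theta_gt0.
rewrite subr_le0 ler_piMr//; first exact: ltW (fair_ratio_gt0 hp).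
by rewrite -[leRHS]expR0 ler_expR mulr_ge0_le0// divr_ge0// ltW ?gamma_gt0 ?gamma_lt1.
Qed.

Theorem proposition3 (R : realType) (p : params R) (hp : admissible p)
    (d : measure_display) (Om : measurableType d) (P : probability Om R)
    (Ft : nat -> set (set Om)) (hFt : filtration Ft)
    (Abar : R) (hA : 0 < Abar) :
  (* closed forms at any steady-state equilibrium *)
  (forall (i0bar pi Mpbar : R) (e : Om -> trajectory R),
     steady_state_equilibrium p P Ft Abar i0bar pi Mpbar e ->
     pi = (- ln (delta p) - i0bar) / (psi p - 1) /\
     0 < ss_fairness p pi /\
     Mpbar = ss_perceived_markup p pi /\
     fairness p Mpbar Mpbar = ss_fairness p pi /\
     fairness_elasticity p Mpbar Mpbar = ss_elasticity p pi /\
     (forall (om : Om) (j : R) (t : nat), unit_itv j ->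
        markup p (e om) j t = ss_markup p pi) /\
     (forall (om : Om) (t : nat), employment (e om) t = ss_employment p pi)) /\
  (* monotonicity over the rates at which the fairness factor is positive *)
  (forall pi1 pi2 : R,
     0 < ss_fairness p pi1 -> 0 < ss_fairness p pi2 -> pi1 < pi2 ->
     ss_markup p pi2 < ss_markup p pi1 /\
     ss_employment p pi1 < ss_employment p pi2) /\
  (* long-run Phillips curve: closed form, upward sloping, not vertical *)
  long_run_phillips_curve p P Ft Abar
    = [set c : R * R | 0 < ss_fairness p c.1 /\ c.2 = ss_employment p c.1] /\
  (forall x y : R * R,
     long_run_phillips_curve p P Ft Abar x ->
     long_run_phillips_curve p P Ft Abar y -> x.1 < y.1 -> x.2 < y.2) /\
  ~ (exists n : R, forall x : R * R,
       long_run_phillips_curve p P Ft Abar x -> x.2 = n).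
Proof.
have PC : long_run_phillips_curve p P Ft Abar
    = [set c : R * R | 0 < ss_fairness p c.1 /\ c.2 = ss_employment p c.1].
  apply/seteqP; split=> [[pi n]|[pi n]] /=.
    move=> [i0bar [Mpbar [e [ee nE]]]].
    have [_ [F0 [_ [_ [_ [_ eE]]]]]] := steady_state_closed_forms hp hFt ee.
    have [om _] := probability_inhabited P; split=> //.
    by have := nE om 0%N; rewrite eE.
  move=> [F0 ->]; exists (- ln (delta p) - (psi p - 1) * pi).
  exists (ss_perceived_markup p pi), (fun=> steady_trajectory p Abar pi).
  split; first exact: steady_trajectory_equilibrium.
  by move=> om t; exact: (steady_trajectory_employment hp hA).
split=> [i0bar pi Mpbar e|]; first exact: steady_state_closed_forms.
split; first by move=> pi1 pi2; exact: ss_monotone.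
split=> //; rewrite PC; split=> [x y [Fx ->] [Fy ->] xy|[n nE]].
  by have [] := ss_monotone hp Fx Fy xy.
(* The rates -1 and 0 both lie on the curve, and strict monotonicity separates their employment
   levels, so the curve is not vertical. *)
have lt10 : -1 < 0 :> R by rewrite oppr_lt0.
have F0 := ss_fairness_gt0_le0 hp (lexx 0).
have F1 := ss_fairness_gt0_le0 hp (ltW lt10).
have E0 : ss_employment p 0 = n := nE (0, _) (conj F0 erefl).
have E1 : ss_employment p (-1) = n := nE (-1, _) (conj F1 erefl).
by have [_] := ss_monotone hp F1 F0 lt10; rewrite E0 E1 ltxx.
Qed.
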